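(* Let $n\geq 0$, let $a,b\in\mathbb{C}[z_0,\ldots,z_n]$, write $\bar z=(z_0,\ldots,z_n)$, and let $X=\{x^2y=a(\bar z)+xb(\bar z)\}\subset\mathbb{C}^{n+3}$ with the holomorphic volume form $\omega=\frac{dx}{x^2}\wedge dz_0\wedge\cdots\wedge dz_n$. Assume that condition (A) holds: there is some $0\le k\le n$ such that $\deg_{z_i}(a)\leq 2$ and $\deg_{z_i}(b)\leq 1$ for all $i\leq k$, and for every common zero $\bar q=(q_0,\ldots,q_n)\in\mathbb{C}^{n+1}$ of $a,\frac{\partial a}{\partial z_0},\ldots,\frac{\partial a}{\partial z_k}$ we have $b(\bar q)\neq 0$ and there is some $j\leq k$ such that $\frac{\partial a}{\partial z_j}$ does not vanish identically along the line $\{z_i=q_i\text{ for all }i\neq j\}\subset\mathbb{C}^{n+1}$. Then the group $\mathrm{Aut}_{\mathrm{hol}}(X)$ of holomorphic automorphisms acts transitively on $X$. Assume that additionally condition (B) holds: there is some $0\le k\le n$ such that $\deg_{z_i}(a)\leq 2$ and $\deg_{z_i}(b)\leq 1$ for all $i\leq k$, and there is no $c\in\mathbb{C}^*$ for which the polynomials $\frac{\partial a}{\partial z_i}+c\frac{\partial b}{\partial z_i}$, $i\leq k$, are all identically zero. Then the group $\mathrm{Aut}^{\omega}_{\mathrm{hol}}(X)$ of volume preserving holomorphic automorphisms acts transitively on $X$.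
   Context: Condition (A) implies that $X$ is smooth. The form $\omega=\frac{dx}{x^2}\wedge dz_0\wedge\cdots\wedge dz_n$ on $X\cap\{x\neq0\}$ extends to a nowhere vanishing holomorphic volume form on $X$, also denoted $\omega$. $\mathrm{Aut}^{\omega}_{\mathrm{hol}}(X)$ is the group of holomorphic automorphisms $\phi$ of $X$ with $\phi^*\omega=\omega$. *)

(* Defs.v *)
From HB Require Import structures.
From mathcomp Require Import all_boot all_order all_algebra.
From mathcomp Require Import all_classical reals topology normedtype derive.
From mathcomp Require Import complex.
(* The notations of mpoly clash with those of MathComp-Analysis. *)
From mathcomp Require Import -(notations) mpoly.
From mathcomp Require Import ring.

Set Implicit Arguments.
Unset Strict Implicit.
Unset Printing Implicit Defensive.

Import Order.TTheory GRing.Theory Num.Theory.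
Import numFieldNormedType.Exports.

Local Open Scope classical_set_scope.
Local Open Scope ring_scope.

(* Ascribing numClosedFieldType gives the complex numbers the normed space
   structure that MathComp-Analysis puts on every numFieldType; differentiable
   maps between normed spaces over [Cplx R] are thus complex differentiable. *)
Definition Cplx (R : realType) : numClosedFieldType := complex R.

Section HolomorphicOnSubset.
Context {K : numFieldType} {V W : normedModType K}.

Definition holo_extension (X : set V) (f : V -> W) (p : V) (F : V -> W) : Prop :=
  \forall q \near p, differentiable F q /\ (X q -> F q = f q).

(* Only the restriction of [f] to [X] matters. *)
Definition holomorphic_on (X : set V) (f : V -> W) : Prop :=
  forall p, X p -> exists F, holo_extension X f p F.

End HolomorphicOnSubset.

(* Holomorphic automorphisms of [X], represented by maps of the ambient space
   whose values outside [X] are irrelevant. *)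
Definition Aut_hol (K : numFieldType) (V : normedModType K) (X : set V) :
    set (V -> V) :=
  [set phi : V -> V | [/\ {homo phi : p / X p}, holomorphic_on X phi &
    exists psi : V -> V, [/\ {homo psi : p / X p}, holomorphic_on X psi,
      forall p, X p -> psi (phi p) = p &
      forall p, X p -> phi (psi p) = p]]].

Definition acts_transitively_on (T : Type) (G : set (T -> T)) (X : set T) : Prop :=
  forall p q, X p -> X q -> exists2 phi, G phi & phi p = q.

Section Forms.
Context {K : numFieldType} {N : nat}.
Local Notation V := 'rV[K]_N.
Variables (X : set V) (T : V -> set V) (k : nat).

(* A k-form maps a point and a k-tuple of vectors, given as the rows of a
   matrix, to a scalar. A form on [X], with tangent spaces [T], only has
   meaningful values at points of [X] and tangent vectors. *)
Definition kform : Type := V -> 'M[K]_(k, N) -> K.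

Definition tangent_rows (p : V) (v : 'M[K]_(k, N)) : Prop :=
  forall i, T p (row i v).

(* Same formulation as determinant_multilinear and determinant_alternate. *)
Definition alternating_multilinear (w : 'M[K]_(k, N) -> K) : Prop :=
  (forall (u v1 v2 : 'M[K]_(k, N)) (i : 'I_k) (c1 c2 : K),
     row i u = c1 *: row i v1 + c2 *: row i v2 ->
     row' i v1 = row' i u -> row' i v2 = row' i u ->
     w u = c1 * w v1 + c2 * w v2) /\
  (forall (v : 'M[K]_(k, N)) (i j : 'I_k),
     i != j -> row i v = row j v -> w v = 0).

(* [w] is locally the restriction of a holomorphic form of the ambient space. *)
Definition holomorphic_form (w : kform) : Prop :=
  forall p, X p -> exists W : kform, \forall q \near p,
    [/\ alternating_multilinear (W q),
        forall v, differentiable (W^~ v : V -> K) q &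
        X q -> forall v, tangent_rows q v -> w q v = W q v].

Definition nowhere_vanishing (w : kform) : Prop :=
  forall p, X p -> exists2 v, tangent_rows p v & w p v != 0.

(* phi^* w = w. The differential of [phi] at a point of [X] is the restriction
   to the tangent space of the differential of a local holomorphic extension;
   when [X] is smooth this does not depend on the extension. *)
Definition preserves_form (w : kform) (phi : V -> V) : Prop :=
  forall p, X p -> exists2 F : V -> V, holo_extension X phi p F &
    forall v, tangent_rows p v -> w (phi p) (v *m jacobian F p) = w p v.

End Forms.

(* Stated for an abstract scalar field, to be instantiated with [Cplx R]:
   conversion is very slow when [complex R] gets unfolded in proofs. *)
Section Hypersurface.
Context {C : numClosedFieldType} {n : nat}.
(* Coordinates are ordered as (x, y, z_0, ..., z_n). *)
Local Notation V := 'rV[C]_n.+3.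
Variables a b : mpoly n.+1 C.

Definition ix : 'I_n.+3 := ord0.
Definition iy : 'I_n.+3 := lift ord0 ord0.
Definition iz (i : 'I_n.+1) : 'I_n.+3 := lift ord0 (lift ord0 i).

Definition zcoord (p : V) : 'I_n.+1 -> C := fun i => p 0 (iz i).

Definition hypersurface : set V :=
  [set p : V | p 0 ix ^+ 2 * p 0 iy = meval (zcoord p) a + p 0 ix * meval (zcoord p) b].

Definition defining_fun (p : V) : C :=
  p 0 ix ^+ 2 * p 0 iy - (meval (zcoord p) a + p 0 ix * meval (zcoord p) b).

Definition tangent_space (p : V) : set V :=
  [set v : V | 'd defining_fun p v = 0].

(* [w] is the holomorphic volume form on [hypersurface] which extends
   dx/x^2 /\ dz_0 /\ ... /\ dz_n: deleting the column [iy] of [v] leaves the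
   matrix of the values of dx, dz_0, ..., dz_n on the rows of [v]. *)
Definition is_volume_form (w : kform n.+2) : Prop :=
  [/\ holomorphic_form hypersurface tangent_space w,
      nowhere_vanishing hypersurface tangent_space w &
      forall p, hypersurface p -> p 0 ix != 0 ->
        forall v, tangent_rows tangent_space p v ->
          w p v = (p 0 ix ^+ 2)^-1 * \det (col' iy v)].

Definition Aut_vol (w : kform n.+2) : set (V -> V) :=
  [set phi : V -> V | Aut_hol hypersurface phi /\
             preserves_form hypersurface tangent_space w phi].

Definition degz (i : 'I_n.+1) (p : mpoly n.+1 C) : nat :=
  \max_(m <- msupp p) m i.

Definition degree_bounds (k : 'I_n.+1) : Prop :=
  forall i : 'I_n.+1, (i <= k)%N -> (degz i a <= 2)%N /\ (degz i b <= 1)%N.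

Definition condition_A : Prop :=
  exists k : 'I_n.+1, degree_bounds k /\
    forall q : 'I_n.+1 -> C,
      meval q a = 0 ->
      (forall i : 'I_n.+1, (i <= k)%N -> meval q (mderiv i a) = 0) ->
      meval q b != 0 /\
      exists2 j : 'I_n.+1, (j <= k)%N &
        ~ (forall r : 'I_n.+1 -> C, (forall i, i != j -> r i = q i) ->
             meval r (mderiv j a) = 0).

Definition condition_B : Prop :=
  exists k : 'I_n.+1, degree_bounds k /\
    ~ (exists2 c : C, c != 0 &
         forall i : 'I_n.+1, (i <= k)%N -> mderiv i a + c *: mderiv i b = 0).

End Hypersurface.

(* Under condition (A) the form of [is_volume_form] does exist. *)

Lemma diff_near_neq0 (K : numFieldType) (V : normedModType K) (f : V -> K) p :
  differentiable f p -> f p != 0 -> \forall q \near p, f q != 0.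
Proof.
move=> /differentiable_continuous cf fp.
have := @cvgr_neq0 K K V (nbhs p) _ f (f p) cf fp. exact.
Qed.

Section VolumeFormExists.
Context {C : numClosedFieldType} {n : nat}.
Local Notation V := 'rV[C]_n.+3.

Lemma coord_is_diff_gen (K : numFieldType) m (i : 'I_m) (q : 'rV[K]_m) :
  is_diff q (fun v : 'rV[K]_m => v 0 i : K) (fun h : 'rV[K]_m => h 0 i).
Proof.
split; first exact: differentiable_coord.
have @f : {linear 'rV[K]_m -> K}.
  by exists (fun N : 'rV[K]_m => N 0 i); do 2![eexists]; do ?[constructor];
     rewrite ?mxE// => ? *; rewrite ?mxE//; move=> ?; rewrite !mxE.
rewrite (_ : (fun _ => _) = f) //; apply: diff_lin; exact: coord_continuous.
Qed.

Lemma coord_is_diff (i : 'I_n.+3) (q : V) :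
  is_diff q (fun v : V => v 0 i : C) (fun h : V => h 0 i).
Proof. exact: coord_is_diff_gen. Qed.

Definition has_formal_diff (p : mpoly n.+1 C) := forall q : V,
  is_diff q (fun v : V => meval (zcoord v) p : C)
   (fun h : V => \sum_i meval (zcoord q) (mderiv i p) * h 0 (iz i)).

Lemma has_formal_diffD p1 p2 : has_formal_diff p1 -> has_formal_diff p2 -> has_formal_diff (p1 + p2).
Proof.
move=> h1 h2 q.
have := is_diffD (h1 q) (h2 q).
congr (is_diff_def _ _ _).
  by apply/funext => v; rewrite mevalD.
apply/funext => h; rewrite -[LHS]/(_ + _) -big_split; apply: eq_bigr => i _ /=.
by rewrite mderivD mevalD mulrDl.
Qed.

Lemma has_formal_diffM p1 p2 : has_formal_diff p1 -> has_formal_diff p2 -> has_formal_diff (p1 * p2).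
Proof.
move=> h1 h2 q.
have := is_diffM (h1 q) (h2 q).
congr (is_diff_def _ _ _).
  by apply/funext => v; rewrite mevalM.
apply/funext => h.
rewrite -[LHS]/(_ * _ + _ * _) !mulr_sumr -big_split; apply: eq_bigr => i _ /=.
by rewrite mderivM mevalD !mevalM; ring.
Qed.

Lemma has_formal_diffC c : has_formal_diff (mpolyC _ c).
Proof.
move=> q; have := is_diff_cst (c : C) q.
congr (is_diff_def _ _ _).
  by apply/funext => v; rewrite mevalC.
by apply/funext => h; rewrite big1// => i _; rewrite mderivC meval0 mul0r.
Qed.

Lemma has_formal_diffX i : has_formal_diff (mpolyX _ (mnm1 i)).
Proof.
move=> q; have := coord_is_diff (iz i) q.
congr (is_diff_def _ _ _).
  by apply/funext => v; rewrite mevalXU.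
apply/funext => h; rewrite (bigD1 i)//= big1 ?addr0.
  rewrite mderivX mevalZ mnm1E eqxx mul1r.
  have -> : mnm_sub (mnm1 i) (mnm1 i) = mnm0.
     by apply/mnmP => j; rewrite mnmBE subnn mnm0E.
  by rewrite mpolyX0 meval1 mul1r.
by move=> j ji; rewrite mderivX mevalZ mnm1E eq_sym (negbTE ji) !mul0r.
Qed.

Lemma meval_is_diff p : has_formal_diff p.
Proof.
rewrite [p]mpolyE; elim/big_ind : _.
- by rewrite -mpolyC0; exact: has_formal_diffC.
- exact: has_formal_diffD.
move=> m _; rewrite -mul_mpolyC; apply: has_formal_diffM; first exact: has_formal_diffC.
rewrite mpolyXE_id; elim/big_ind : _.
- by rewrite -[1]/(mpolyC n.+1 1); exact: has_formal_diffC.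
- exact: has_formal_diffM.
move=> i _; elim: (m i) => [|k IH].
  by rewrite expr0 -[1]/(mpolyC n.+1 1); exact: has_formal_diffC.
by rewrite exprS; apply: has_formal_diffM => //; exact: has_formal_diffX.
Qed.

Variables a b : mpoly n.+1 C.

Definition gradient_entry (p : V) (j : 'I_n.+3) : C :=
  if unlift ord0 j is Some j' then
    if unlift ord0 j' is Some i then
     - (meval (zcoord p) (mderiv i a) + p 0 ix * meval (zcoord p) (mderiv i b))
    else p 0 ix ^+ 2
  else 2 * p 0 ix * p 0 iy - meval (zcoord p) b.
Definition gradient (p : V) : 'cV[C]_n.+3 := \col_j gradient_entry p j.

Lemma defining_fun_is_diff q : is_diff q (defining_fun a b : V -> C) (fun h => (h *m gradient q) 0 0).
Proof.
have hx := coord_is_diff ix q. have hy := coord_is_diff iy q.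
have ha := meval_is_diff a q. have hb := meval_is_diff b q.
have := is_diffB (is_diffM (is_diffM hx hx) hy) (is_diffD ha (is_diffM hx hb)).
congr (is_diff_def _ _ _).
apply/funext => h.
rewrite !mxE big_ord_recl big_ord_recl /= !mxE.
set S := (X in _ = _ + (_ + X)).
have -> : S = - \sum_i meval (zcoord q) (mderiv i a) * h 0 (iz i) - q 0 ix * \sum_i meval (zcoord q) (mderiv i b) * h 0 (iz i).
  rewrite /S mulr_sumr -!sumrN -big_split; apply: eq_bigr => i _ /=.
  by rewrite !mxE /gradient_entry !liftK -/(iz i); ring.
rewrite /gradient_entry !unlift_none liftK unlift_none.
rewrite -[LHS]/((q 0 ix * q 0 ix) * h 0 iy + q 0 iy * (q 0 ix * h 0 ix + q 0 ix * h 0 ix) - (_ + (_ * _ + _ * _))).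
rewrite -/ix -/iy; ring.
Qed.

Lemma tangentE q (v : V) : tangent_space a b q v <-> v *m gradient q = 0.
Proof.
have e := @diff_val _ _ _ _ _ _ _ (defining_fun_is_diff q).
rewrite /tangent_space /= e; split => [h|->]; last by rewrite mxE.
by apply/matrixP => i j; rewrite !ord1 h mxE.
Qed.

Lemma tangent_rowsE k q (v : 'M[C]_(k, n.+3)) : tangent_rows (tangent_space a b) q v <-> v *m gradient q = 0.
Proof.
split=> [h|h i].
  by apply/row_matrixP => i; rewrite row_mul row0; exact/tangentE.
by apply/tangentE; rewrite -row_mul h row0.
Qed.

Lemma differentiable_gradient j q : differentiable (fun p => gradient p j 0 : C) q.
Proof.
rewrite (_ : (fun p => gradient p j 0 : C) = fun p => gradient_entry p j); last first.
  by apply/funext => p; rewrite mxE.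
have hc i : differentiable (fun p : V => p 0 i : C) q by case: (coord_is_diff i q).
have hp p : differentiable (fun v : V => meval (zcoord v) p : C) q by case: (meval_is_diff p q).
rewrite /gradient_entry; case: unliftP => [j' _|_]; first case: unliftP => [i _|_].
- apply: (@differentiableN _ _ _ (fun p : V => meval (zcoord p) (mderiv i a) + p 0 ix * meval (zcoord p) (mderiv i b) : C)).
  apply: (@differentiableD _ _ _ (fun p : V => meval (zcoord p) (mderiv i a)) (fun p : V => p 0 ix * meval (zcoord p) (mderiv i b) : C)) => //.
  exact: (@differentiableM _ _ (fun p : V => p 0 ix) (fun p : V => meval (zcoord p) (mderiv i b) : C)).
- exact: (@differentiableX _ _ (fun p : V => p 0 ix) 1).
apply: (@differentiableB _ _ _ (fun p : V => 2 * p 0 ix * p 0 iy) (fun p : V => meval (zcoord p) b : C)) => //.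
apply: (@differentiableM _ _ (fun p : V => 2 * p 0 ix) (fun p : V => p 0 iy)) => //.
exact: (@differentiableZ _ _ _ (fun p : V => p 0 ix : C) 2).
Qed.

(* Up to sign, the Poincare residue of dx /\ dy /\ dz_0 /\ ... /\ dz_n along the
   hypersurface is the bordered determinant divided by a gradient entry. *)
Definition bordered_det (j : 'I_n.+3) (v : 'M[C]_(n.+2, n.+3)) : C :=
  \det (col_mx (delta_mx 0 j : 'rV_n.+3) v : 'M_n.+3).

Definition residue_form j (q : V) (v : 'M[C]_(n.+2, n.+3)) : C := - (gradient q j 0)^-1 * bordered_det j v.

Lemma col_row' m (e : 'rV[C]_m) k (v : 'M_(k,m)) : row' (ord0 : 'I_k.+1) (col_mx e v) = v.
Proof.
apply/matrixP => i j; rewrite !mxE.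
case: splitP => [k' /= |k' /= []/val_inj->//]; by case: k' => -[].
Qed.

Lemma bordered_detE j v : bordered_det j v = (-1) ^+ j * \det (col' j v).
Proof.
rewrite /bordered_det (expand_det_row _ ord0) (bigD1 j)//= big1 ?addr0.
  rewrite mxE (_ : ord0 = lshift n.+2 (ord0 : 'I_1)); last exact/val_inj.
  rewrite (unsplitK (inl _)) mxE !eqxx mul1r /cofactor/=.
  congr (_ * \det _); apply/matrixP => i k; rewrite !mxE.
  by case: splitP => [k' /= |k' /= []/val_inj->//]; case: k' => -[].
move=> i ij; rewrite mxE (_ : ord0 = lshift n.+2 (ord0 : 'I_1)); last exact/val_inj.
by rewrite (unsplitK (inl _)) mxE (negbTE ij) andbF mul0r.
Qed.

Lemma bordered_det_alternating j : alternating_multilinear (bordered_det j).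
Proof.
split.
- move=> u v1 v2 i c1 c2 h h1 h2; rewrite !bordered_detE.
  rewrite (@determinant_multilinear _ _ (col' j u) (col' j v1) (col' j v2) i c1 c2).
  + ring.
  + by move/rowP: h => h; apply/rowP => k; have := h (lift j k); rewrite !mxE.
  + by clear h; move/matrixP: h1 => h; apply/matrixP => k l; have := h k (lift j l); rewrite !mxE.
  + by clear h; move/matrixP: h2 => h; apply/matrixP => k l; have := h k (lift j l); rewrite !mxE.
- move=> v i k ik h; rewrite bordered_detE (determinant_alternate ik) ?mulr0//.
  by move=> l; move/rowP: h => /(_ (lift j l)); rewrite !mxE.
Qed.

Lemma det_ker m (M : 'M[C]_m) (g : 'cV_m) : g != 0 -> M *m g = 0 -> \det M = 0.
Proof.
move=> g0 Mg; apply/eqP; apply: contraNT g0 => d0.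
have u : M \in unitmx by rewrite unitmxE unitfE.
by rewrite -(mulKmx u g) Mg mulmx0.
Qed.

Lemma residue_form_indep q j j' v : gradient q j 0 != 0 -> gradient q j' 0 != 0 -> v *m gradient q = 0 ->
  residue_form j q v = residue_form j' q v.
Proof.
move=> h h' vG.
suff e : gradient q j' 0 * bordered_det j v = gradient q j 0 * bordered_det j' v.
  rewrite /residue_form !mulNr; congr (- _).
  by apply: (mulfI h); rewrite mulVKf//; apply: (mulfI h'); rewrite e [RHS]mulrCA mulVKf.
pose e0 : 'rV[C]_n.+3 := gradient q j' 0 *: delta_mx 0 j - gradient q j 0 *: delta_mx 0 j'.
have dl i : delta_mx 0 i *m gradient q = (gradient q i 0)%:M.
  by rewrite -rowE; apply/matrixP => k l; rewrite !ord1 !mxE eqxx mulr1n.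
have : \det (col_mx e0 v : 'M_n.+3) = 0.
  apply: (@det_ker _ _ (gradient q)).
    by apply: contraNneq h => ->; rewrite mxE.
  apply: etrans (mul_col_mx e0 v (gradient q)) _.
  rewrite vG mulmxBl -!scalemxAl !dl.
  have -> : gradient q j' 0 *: (gradient q j 0)%:M - gradient q j 0 *: (gradient q j' 0)%:M = 0 :> 'M_1.
    by rewrite !scale_scalar_mx mulrC subrr.
  exact: col_mx0.
rewrite (@determinant_multilinear _ n.+3 _ (col_mx (delta_mx 0 j : 'rV_n.+3) v : 'M_n.+3) (col_mx (delta_mx 0 j' : 'rV_n.+3) v : 'M_n.+3) ord0 (gradient q j' 0) (- gradient q j 0)).
- by rewrite mulNr => /eqP; rewrite subr_eq0 => /eqP.
- apply/rowP => k; rewrite (_ : ord0 = lshift n.+2 (ord0 : 'I_1)); last exact/val_inj.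
  by rewrite ![row _ _ _ _]mxE !mxE !(unsplitK (inl _)) !mxE mulNr.
- by rewrite !col_row'.
- by rewrite !col_row'.
Qed.

Definition smooth := forall p, hypersurface a b p -> exists j, gradient p j 0 != 0.

Lemma condition_A_smooth : condition_A a b -> smooth.
Proof.
move=> [k [_ h]] p; rewrite /hypersurface /= => Xp.
have [x0|x0] := eqVneq (p 0 ix) 0; last first.
  by exists iy; rewrite mxE /gradient_entry liftK unlift_none expf_neq0.
have a0 : meval (zcoord p) a = 0 by move: Xp; rewrite x0 expr0n !mul0r addr0.
apply: contrapT => hn.
have G0 j : gradient_entry p j = 0.
  by apply/eqP; apply/negPn/negP => hj; apply: hn; exists j; rewrite mxE.
have [] := h (zcoord p) a0.
  move=> i _; have := G0 (iz i); rewrite /gradient_entry !liftK x0 mul0r addr0 => /eqP.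
  by rewrite oppr_eq0 => /eqP.
have := G0 ix; rewrite /gradient_entry unlift_none x0 mulr0 mul0r sub0r => /eqP.
by rewrite oppr_eq0 => ->.
Qed.

Lemma smooth_volume_form_exists : smooth -> exists w, is_volume_form a b w.
Proof.
move=> sm.
exists (fun q v => if [pick j | gradient q j 0 != 0] is Some j then residue_form j q v else 0).
split.
- move=> p Xp; have [j hj] := sm p Xp; exists (residue_form j).
  have : \forall q \near p, gradient q j 0 != 0 :> C.
    apply: (@diff_near_neq0 _ _ (fun p : V => gradient p j 0 : C) p) => //; exact: differentiable_gradient.
  apply: filterS => q hq; split.
  + have [m al] := bordered_det_alternating j; split.
      by move=> u v1 v2 i c1 c2 h h1 h2; rewrite /residue_form (m _ _ _ _ _ _ h h1 h2); ring.
    by move=> v i i' ii h; rewrite /residue_form (al _ _ _ ii h) mulr0.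
  + move=> v; rewrite /residue_form.
    rewrite (_ : (fun x => _) = (- bordered_det j v) *: (fun x : V => (gradient x j 0)^-1 : C)); last first.
      by apply/funext => x; rewrite -[RHS]/(_ * _); ring.
    apply: differentiableZ; apply: differentiableV => //; exact: differentiable_gradient.
  + move=> _ v /tangent_rowsE vG; case: pickP => [j' hj'|/(_ j)]; last by rewrite hq.
    exact: residue_form_indep.
- move=> p Xp; have [j hj] := sm p Xp.
  pose A : 'M[C]_n.+3 := 1%:M - (gradient p j 0)^-1 *: (gradient p *m (delta_mx 0 j : 'rV_n.+3)).
  have dl i : delta_mx 0 i *m gradient p = (gradient p i 0)%:M.
    by rewrite -rowE; apply/matrixP => k l; rewrite !ord1 !mxE eqxx mulr1n.
  have AG : A *m gradient p = 0.
    rewrite mulmxBl mul1mx -scalemxAl -mulmxA dl mul_mx_scalar scalerA mulVf//.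
    by rewrite scale1r subrr.
  have vG : row' j A *m gradient p = 0.
    by apply/row_matrixP => i; rewrite row_mul row0 row_rowsub -row_mul AG row0.
  exists (row' j A); first exact/tangent_rowsE.
  case: pickP => [j' hj'|/(_ j)]; last by rewrite hj.
  rewrite (residue_form_indep hj' hj vG) /residue_form mulf_neq0 ?oppr_eq0 ?invr_eq0//.
  rewrite bordered_detE mulf_neq0 ?signr_eq0//.
  rewrite (_ : col' j _ = 1%:M) ?det1 ?oner_eq0//.
  apply/matrixP => i k; rewrite !mxE big1 ?mulr0 ?subr0.
    by rewrite (inj_eq lift_inj).
  by move=> l _; rewrite !mxE (negbTE (_ : lift j k != j)) ?andbF ?mulr0// eq_sym neq_lift.
- move=> p Xp x0 v /tangent_rowsE vG.
  have hy : gradient p iy 0 != 0 by rewrite mxE /gradient_entry liftK unlift_none expf_neq0.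
  case: pickP => [j' hj'|/(_ iy)]; last by rewrite hy.
  rewrite (residue_form_indep hj' hy vG) /residue_form bordered_detE mxE /gradient_entry liftK unlift_none.
  by rewrite /= expr1; ring.
Qed.

Lemma volume_form_exists : condition_A a b -> exists w, is_volume_form a b w.
Proof. by move=> /condition_A_smooth/smooth_volume_form_exists. Qed.

End VolumeFormExists.

(* Main.v *)
Require Import Defs.
From mathcomp Require Import all_boot all_order all_algebra.
From mathcomp Require Import all_classical reals topology normedtype derive.
From mathcomp Require Import -(notations) mpoly.
From mathcomp Require Import complex sequences exp trigo ring lra.

(** Write P = x^2 y - (a + x b), so that X is the zero set of P. Every automorphism
used below is the restriction of an entire map of the ambient space of the form
p |-> p + f1(p) D1 + f2(p) D2 with constant directions D1, D2. Three families
suffice.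

- Slides move z by x^2 e, for a fixed vector e, keep x, and correct y by the
  divided difference of a + x b ([slide]). They act transitively on each slice
  x = c of X with c != 0, where y is determined by x and z
  ([slice_same_orbit]).

- For an index i with deg_{z_i} a <= 2 and deg_{z_i} b <= 1, the polynomial P is
  quadratic in the pair (x, z_i) when the other coordinates are frozen, so its
  Hamiltonian field x' = a_i + x b_i, z_i' = 2xy - b is affine and its flow moves
  points along conics ([conic_flow]). The flow is an explicit expression in two
  entire functions of t^2 D, where D is the discriminant of the quadratic part:
  sinh(sqrt u)/sqrt u and (cosh(sqrt u) - 1)/u. Along an orbit, x is constant or
  takes all complex values except at most one ([time_reach]).

- Dilations multiply x by exp(t a(z)) and fix z; the division by x in the
  resulting formula for y is harmless because a vanishes wherever x does on X
  ([dilation]).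

Slides and conic flows preserve P in the whole ambient space and have Jacobian
determinant 1. The volume form of X is the Poincare residue of the standard form
of the ambient space along P, so such maps preserve it
([unimodular_symmetry_preserves_form]). The residue formula is clear for x != 0;
it extends to x = 0 by continuity, because a conic flow through a point with
x = 0 leaves the divisor x = 0 at once ([approach_path],
[volume_form_residue]).

Transitivity. By condition (A), at each point with x = 0 some conic field has
nonzero velocity or nonzero acceleration in the x-direction, so a conic flow
moves the point to x != 0 ([escape_orbit]). It remains to join the slices x = c,
c != 0. Under (A) alone a is not identically zero, and a dilation at a point with
a(z) != 0 joins any two slices ([slices_connected_hol]). Under (B), each c != 0
admits z and i with a_i(z) + c b_i(z) != 0, so a conic flow joins the slice c to
all slices but one; any two slices are then joined through a common third one
([slices_connected_vol]). *)

Set Implicit Arguments.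
Unset Strict Implicit.
Unset Printing Implicit Defensive.

Import Order.TTheory GRing.Theory Num.Theory.
Import numFieldNormedType.Exports.

Local Open Scope classical_set_scope.
Local Open Scope ring_scope.

(** * Entire maps, and shears along two directions *)

Definition entire (K : numFieldType) (V W : normedModType K) (f : V -> W) : Prop :=
  forall q, differentiable f q.

Section Entire.
Context {K : numFieldType} {V W : normedModType K}.

Lemma entire_cst (c : W) : entire (fun _ : V => c).
Proof. by move=> q; exact: differentiable_cst. Qed.

Lemma entireD (f g : V -> W) : entire f -> entire g -> entire (fun v => f v + g v).
Proof. by move=> hf hg q; exact: (differentiableD (hf q) (hg q)). Qed.

Lemma entireN (f : V -> W) : entire f -> entire (fun v => - f v).
Proof. by move=> hf q; exact: (differentiableN (hf q)). Qed.

Lemma entireM (f g : V -> K) : entire f -> entire g -> entire (fun v => f v * g v).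
Proof. by move=> hf hg q; exact: (differentiableM (hf q) (hg q)). Qed.

Lemma entireX (f : V -> K) m : entire f -> entire (fun v => f v ^+ m).
Proof.
move=> hf; elim: m => [|m IH].
  by rewrite (_ : (fun v => _) = fun=> 1) //; exact: entire_cst.
rewrite (_ : (fun v => _) = fun v => f v * f v ^+ m); first exact: entireM.
by apply/funext => v; rewrite exprS.
Qed.

Lemma entireZl (f : V -> K) (w : W) : entire f -> entire (fun v => f v *: w).
Proof. by move=> hf q; exact: (differentiableZl w (hf q)). Qed.

Lemma entire_comp (U : normedModType K) (f : U -> V) (g : V -> W) :
  entire f -> entire g -> entire (fun u => g (f u)).
Proof. by move=> hf hg q; exact: (differentiable_comp (hf q) (hg _)). Qed.

Lemma entire_id : entire (@id V).
Proof. by move=> q; case: (is_diff_id q). Qed.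

Lemma entire_holo_extension (X : set V) (f : V -> W) p :
  entire f -> holo_extension X f p f.
Proof. by move=> ef; rewrite /holo_extension; apply: nearW => q; split=> //; exact: ef. Qed.

(** If f is affine along the line p + K v, its slope there is the directional
derivative; this replaces derivative rules in all the Jacobians below. *)
Lemma diff_along_line (f : V -> W) p v c : differentiable f p ->
  (forall h : K, f (p + h *: v) = f p + h *: c) -> 'd f p v = c.
Proof.
move=> df hl.
rewrite -deriveE // /derive.
apply/cvg_lim => //.
apply: (cvg_trans _ (cvg_cst c)).
apply: near_eq_cvg.
apply: filterS (nbhs_dnbhs_neq (0 : K)) => h h0 /=.
by rewrite [h *: v + p]addrC hl addrAC subrr add0r scalerA mulVf ?scale1r.
Unshelve. all: try typeclasses eauto.
Qed.

End Entire.

Lemma diff_along_line1 (K : numFieldType) (V : normedModType K) (f : V -> K) p v c :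
  differentiable f p -> (forall h : K, f (p + h *: v) = f p + h * c) -> 'd f p v = c.
Proof. exact: diff_along_line. Qed.

(** Sylvester's identity, from conjugating a block triangular matrix. It turns the
Jacobian determinant of a shear into a 2 x 2 determinant. *)
Lemma det_add1_mulmx (K : comUnitRingType) m k (U : 'M[K]_(m, k)) (W : 'M[K]_(k, m)) :
  \det (1%:M + U *m W) = \det (1%:M + W *m U).
Proof.
have e1 : block_mx 1%:M 0 W 1%:M *m block_mx (1%:M + U *m W) U 0 1%:M *m block_mx 1%:M 0 (- W) 1%:M
  = block_mx 1%:M U 0 (1%:M + W *m U).
  rewrite !mulmx_block !(mulmx1, mul1mx, mul0mx, mulmx0, addr0, add0r).
  rewrite mulmxN addrK; congr block_mx; last by rewrite addrC.
  rewrite mulmxN mulmxDr mulmxDl mulmx1 mul1mx mulmxA.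
  by rewrite [W + _]addrC subrr.
have := congr1 (fun M => \det M) e1.
by rewrite !det_mulmx !det_lblock !det_ublock !det1 !(mul1r, mulr1).
Qed.

Section Shear.
Context {K : numFieldType} {N : nat}.
Local Notation V := 'rV[K]_N.

Definition shear (f1 f2 : V -> K) (D1 D2 : V) (p : V) : V :=
  p + f1 p *: D1 + f2 p *: D2.

Lemma entire_shear f1 f2 D1 D2 : entire f1 -> entire f2 -> entire (shear f1 f2 D1 D2).
Proof.
move=> h1 h2; apply: (@entireD _ _ _ (fun p => p + f1 p *: D1)); last exact: entireZl.
by apply: entireD; [exact: entire_id | exact: entireZl].
Qed.

Lemma mulmx_jacobian (F : V -> V) p v : v *m jacobian F p = 'd F p v.
Proof. exact: mul_rV_lin1. Qed.

Lemma jacobian_comp (F G : V -> V) p : differentiable F p -> differentiable G (F p) ->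
  jacobian (G \o F) p = jacobian F p *m jacobian G (F p).
Proof.
move=> dF dG; apply/row_matrixP => i; rewrite !rowE mulmxA.
apply: (etrans (mulmx_jacobian (G \o F) p _)).
apply: esym; apply: (etrans (mulmx_jacobian G (F p) _)).
apply: (etrans (congr1 ('d G (F p)) (mulmx_jacobian F p _))).
exact: (esym (congr1 (fun f => f (delta_mx 0 i)) (diff_comp dF dG))).
Qed.

(** Chain rule for P o F = P. *)
Lemma diff_invariant (F : V -> V) (P : V -> K) p v : entire F -> entire P ->
  (forall q, P (F q) = P q) -> 'd P (F p) (v *m jacobian F p) = 'd P p v.
Proof.
move=> eF eP h; apply: (etrans (congr1 ('d P (F p)) (mulmx_jacobian F p _))).
have e : P \o F = P by apply/funext.
have := diff_comp (eF p) (eP (F p)).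
by rewrite e => c; exact: (esym (congr1 (fun f => f v) c)).
Qed.

Definition unimodular (F : V -> V) : Prop := forall p, \det (jacobian F p) = 1.

Lemma unimodular_comp (F G : V -> V) : entire F -> entire G ->
  unimodular F -> unimodular G -> unimodular (G \o F).
Proof.
move=> eF eG uF uG p; rewrite (jacobian_comp (eF p) (eG (F p))).
move: (uF p) (uG (F p)).
move: (jacobian F p) (jacobian G (F p)) => A B dA dB.
by rewrite det_mulmx dA dB mulr1.
Qed.

Lemma is_diff_Zl (f : V -> K) (D : V) p : entire f ->
  is_diff p (fun z : V => f z *: D) (fun v => 'd f p v *: D).
Proof. by move=> hf; split; [exact: entireZl | rewrite diffZl]. Qed.

Lemma mulmx_jacobian_shear f1 f2 D1 D2 p v : entire f1 -> entire f2 ->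
  v *m jacobian (shear f1 f2 D1 D2) p = v + 'd f1 p v *: D1 + 'd f2 p v *: D2.
Proof.
move=> h1 h2; rewrite mulmx_jacobian.
have e := is_diffD (is_diffD (is_diff_id p) (is_diff_Zl D1 p h1)) (is_diff_Zl D2 p h2).
by rewrite -[shear _ _ _ _]/((id + _) + _) (@diff_val _ _ _ _ _ _ _ e).
Qed.

End Shear.

Section RankTwoUpdate.
Context {K : numFieldType} {N : nat}.
Local Notation V := 'rV[K]_N.

Lemma linear_form_colE (f : {linear V -> K}) v :
  v *m (\col_i f (delta_mx 0 i)) = (f v)%:M :> 'M_1.
Proof.
apply/matrixP => i j; rewrite !ord1 !mxE eqxx mulr1n.
rewrite [in RHS](row_sum_delta v) linear_sum; apply: eq_bigr => k _.
by rewrite mxE linearZ.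
Qed.

Lemma det_rank_two_update (l1 l2 : {linear V -> K}) (D1 D2 : V) (M : 'M[K]_N) :
  (forall v, v *m M = v + l1 v *: D1 + l2 v *: D2) ->
  \det M = (1 + l1 D1) * (1 + l2 D2) - l2 D1 * l1 D2.
Proof.
move=> hM.
pose c1 : 'cV[K]_N := \col_i l1 (delta_mx 0 i).
pose c2 : 'cV[K]_N := \col_i l2 (delta_mx 0 i).
have -> : M = 1%:M + row_mx c1 c2 *m col_mx D1 D2.
  apply/row_matrixP => i; rewrite !rowE hM mulmxDr mulmx1.
  rewrite (@mul_row_col _ N 1 1 N) mulmxDr (mulmxA _ c1) (mulmxA _ c2).
  by rewrite (linear_form_colE l1) (linear_form_colE l2) !mul_scalar_mx addrA.
rewrite det_add1_mulmx mul_col_row.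
rewrite !(linear_form_colE l1) !(linear_form_colE l2).
move: (l1 D1) (l1 D2) (l2 D1) (l2 D2) => x11 x12 x21 x22.
rewrite (@scalar_mx_block _ 1 1 1) add_block_mx !add0r -!raddfD.
rewrite (expand_det_row _ (lshift 1 ord0)) big_split_ord !big_ord1 /=.
rewrite /cofactor !det_mx11 !mxE.
have -> : lift (lshift 1 (ord0 : 'I_1)) 0 = rshift 1 (ord0 : 'I_1) by exact/val_inj.
have -> : lift (rshift 1 (ord0 : 'I_1)) 0 = lshift 1 (ord0 : 'I_1) by exact/val_inj.
rewrite !(unsplitK (inl _)) !(unsplitK (inr _)) !mxE !(unsplitK (inl _)) !(unsplitK (inr _)) !mxE /=.
by rewrite expr0 expr1 mul1r mulN1r mulrN !mulr1n.
Qed.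
End RankTwoUpdate.

Lemma det_jacobian_shear (K : numFieldType) N (f1 f2 : 'rV[K]_N -> K) D1 D2 p
    x11 x12 x21 x22 : entire f1 -> entire f2 ->
  'd f1 p D1 = x11 -> 'd f1 p D2 = x12 -> 'd f2 p D1 = x21 -> 'd f2 p D2 = x22 ->
  \det (jacobian (shear f1 f2 D1 D2) p) = (1 + x11) * (1 + x22) - x21 * x12.
Proof.
move=> h1 h2 <- <- <- <-; apply: (@det_rank_two_update _ _ ('d f1 p) ('d f2 p)) => v.
exact: mulmx_jacobian_shear.
Qed.

(** * The exponential and hyperbolic functions of a square root *)

Section ExpPair.
Context {C : numClosedFieldType}.

(** E is the exponential and S(u) is sinh(sqrt u) / sqrt u. The
geometry is developed from these properties over an abstract closed field. *)
Definition exp_pair (E S : C -> C) : Prop :=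
  [/\ entire E /\ entire S, forall u v, E (u + v) = E u * E v,
      forall l, l != 0 -> exists w, E w = l, S 0 = 1 &
      forall w, 2 * (w * S (w ^+ 2)) = E w - E (- w)].

Variables E S : C -> C.
Hypothesis ES : exp_pair E S.

Lemma exp_pair0 : E 0 = 1.
Proof.
have [_ hD hs _ _] := ES; have [w hw] := hs 1 (oner_neq0 C).
by rewrite -[LHS]mul1r -hw -hD addr0.
Qed.

Lemma exp_pairN w : E w * E (- w) = 1.
Proof. by have [_ hD _ _ _] := ES; rewrite -hD subrr exp_pair0. Qed.

(** This is (cosh(sqrt u) - 1) / u, by the half-angle formula
cosh w - 1 = 2 sinh(w/2)^2; in this form it is visibly entire. *)
Definition versc (u : C) : C := S (u / 4) ^+ 2 / 2.

Lemma exp_pair_half w : exists e f, [/\ e * f = 1, E w = e ^+ 2, E (- w) = f ^+ 2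
  & w * S (w ^+ 2 / 4) = e - f].
Proof.
have [_ hD _ _ h] := ES; exists (E (w / 2)), (E (- (w / 2))); split.
- exact: exp_pairN.
- by rewrite expr2 -hD; congr E; field.
- by rewrite expr2 -hD; congr E; field.
rewrite -h (_ : (w / 2) ^+ 2 = w ^+ 2 / 4); last by field.
by field.
Qed.

Lemma sinhS w : w * S (w ^+ 2) = (E w - E (- w)) / 2.
Proof. by have [_ _ _ _ <-] := ES; field. Qed.

Lemma verscE w : w ^+ 2 * versc (w ^+ 2) = (E w + E (- w) - 2) / 2.
Proof.
have [e [f [ef -> -> h]]] := exp_pair_half w.
transitivity ((w * S (w ^+ 2 / 4)) ^+ 2 / 2); first by rewrite /versc; field.
rewrite h; transitivity ((e ^+ 2 + f ^+ 2 - 2 * (e * f)) / 2); first by field.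
by rewrite ef mulr1.
Qed.

Lemma versc0 : versc 0 = 1 / 2.
Proof. by have [_ _ _ h _] := ES; rewrite /versc mul0r h expr1n. Qed.

(** The identity cosh^2 - sinh^2 = 1, divided by u. *)
Lemma sinhc_versc u : S u ^+ 2 = versc u * (2 + u * versc u).
Proof.
have [->|u0] := eqVneq u 0.
  by have [_ _ _ -> _] := ES; rewrite versc0; field.
have hu := sqrtCK u; set w := sqrtC u in hu.
have w0 : w != 0 by apply: contraNneq u0 => w0; rewrite -hu w0 expr0n.
rewrite -hu; apply: (mulfI (expf_neq0 2 w0)).
rewrite -exprMn sinhS.
transitivity ((w ^+ 2 * versc (w ^+ 2)) * (2 + w ^+ 2 * versc (w ^+ 2))); last by ring.
rewrite verscE; have := exp_pairN w; move: (E w) (E (- w)) => e f ef.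
transitivity (((e + f) ^+ 2 - 4 * (e * f)) / 4); first by field.
by rewrite ef; field.
Qed.

(** With A the matrix of an affine field of the plane and A^2 = d, the flow at time
t is u |-> u + s A' + r A A', where A' is the velocity at u,
s = sinh(t sqrt d) / sqrt d and r = (cosh(t sqrt d) - 1) / d. *)
Definition time_s (t d : C) : C := t * S (t ^+ 2 * d).
Definition time_r (t d : C) : C := t ^+ 2 * versc (t ^+ 2 * d).

(** This relation alone makes the flow formula preserve P, have determinant 1 and
be inverted by s |-> - s. *)
Lemma time_sr t d : time_s t d ^+ 2 = time_r t d * (2 + d * time_r t d).
Proof. by rewrite /time_s /time_r exprMn sinhc_versc; ring. Qed.

Lemma entire_versc : entire versc.
Proof.
have [[_ eS] _ _ _ _] := ES.
apply: entireM; last exact: entire_cst.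
apply: entireX; apply: (@entire_comp _ _ _ _ (fun u : C => u / 4) S _ eS).
by apply: entireM; [exact: entire_id | exact: entire_cst].
Qed.

Lemma entire_time t : entire (time_s t) /\ entire (time_r t).
Proof.
have [[_ eS] _ _ _ _] := ES.
have em : entire (fun d : C => t ^+ 2 * d).
  by apply: entireM; [exact: entire_cst | exact: entire_id].
split; (apply: entireM; first exact: entire_cst).
  exact: entire_comp em eS.
exact: entire_comp em entire_versc.
Qed.

Lemma quadratic_root (A B K : C) : A != 0 -> exists l, A * l ^+ 2 + B * l + K = 0.
Proof.
move=> A0; have hr := sqrtCK (B ^+ 2 - 4 * A * K).
set r := sqrtC _ in hr; exists ((r - B) / (2 * A)).
transitivity ((r ^+ 2 - (B ^+ 2 - 4 * A * K)) / (4 * A)).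
  by field.
by rewrite hr subrr mul0r.
Qed.

(** A quadratic equation for l when A and B are nonzero; when one
of them vanishes the equation is solvable with l != 0 exactly because K != 0. *)
Lemma laurent_root (A B K : C) : K != 0 -> (A != 0) || (B != 0) ->
  exists2 l, l != 0 & A * l + B / l = K.
Proof.
move=> K0; have [->|A0] /= := eqVneq A 0.
  move=> B0; exists (B / K); first by rewrite mulf_neq0 ?invr_eq0.
  by rewrite mul0r add0r invf_div mulrC divfK.
move=> _; have [->|B0] := eqVneq B 0.
  exists (K / A); first by rewrite mulf_neq0 ?invr_eq0.
  by rewrite mul0r addr0 mulrC divfK.
have [l hl] := quadratic_root (- K) B A0.
have l0 : l != 0.
  by apply: contraNneq B0 => l0; rewrite -hl l0 expr0n !mulr0 !add0r.
exists l => //; apply: (mulIf l0); rewrite mulrDl divfK //.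
by apply/eqP; rewrite -subr_eq0 -hl; apply/eqP; ring.
Qed.

(** If D = 0 the position is a nonconstant polynomial in t. If D = w0^2 != 0 and
l = E(t w0), it is x - g / D + A l + B / l for constants A, B not both zero, which
takes every value except possibly x - g / D. *)
Lemma time_reach (x D f g : C) : (f != 0) || (g != 0) ->
  exists e, forall c, c != e -> exists t, x + (time_s t D * f + time_r t D * g) = c.
Proof.
move=> fg; have [D0|D0] := eqVneq D 0.
  exists 0 => c _.
  have S0 : S 0 = 1 by have [_ _ _ h _] := ES.
  suff [t ht] : exists t, g / 2 * t ^+ 2 + f * t + (x - c) = 0.
    exists t; apply/eqP; rewrite -subr_eq0 -ht; apply/eqP.
    by rewrite /time_s /time_r D0 mulr0 S0 versc0; field.
  have [g0|g0] := eqVneq g 0.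
    rewrite g0 eqxx orbF in fg.
    by exists ((c - x) / f); rewrite g0; field.
  by apply: quadratic_root; rewrite mulf_neq0 // invr_eq0 pnatr_eq0.
have hD := sqrtCK D; set w0 := sqrtC D in hD.
have w00 : w0 != 0 by apply: contraNneq D0 => w0z; rewrite -hD w0z expr0n.
exists (x - g / D) => c hc.
pose A := (f / w0 + g / D) / 2; pose B := (g / D - f / w0) / 2.
have AB : (A != 0) || (B != 0).
  rewrite -negb_and; apply: contraTN fg => /andP[/eqP hA /eqP hB].
  have hf : f = (A - B) * w0 by rewrite /A /B; field; rewrite ?D0 ?w00.
  have hg : g = (A + B) * D by rewrite /A /B; field; rewrite ?D0 ?w00.
  by rewrite hf hg hA hB subrr addr0 !mul0r eqxx.
have K0 : c - x + g / D != 0 by apply: contraNneq hc => h; apply/eqP; rewrite -[LHS]subr0 -h; ring.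
have [l l0 hl] := laurent_root K0 AB.
have [_ _ hs _ _] := ES; have [w hw] := hs l l0.
have hw' : E (- w) = l^-1.
  by apply: (mulfI l0); rewrite -{1}hw exp_pairN mulfV.
exists (w / w0).
have e : (w / w0) ^+ 2 * D = w ^+ 2 by rewrite -hD; field.
have h1 := sinhS w; have h2 := verscE w; rewrite hw hw' in h1 h2.
rewrite /time_s /time_r e.
transitivity (x + (w * S (w ^+ 2) * (f / w0) + w ^+ 2 * versc (w ^+ 2) * (g / D))).
  by rewrite -hD; field.
rewrite h1 h2.
transitivity (x - g / D + (A * l + B / l)); last by rewrite hl; ring.
by rewrite /A /B; field; rewrite ?l0 ?D0 ?w00.
Qed.
End ExpPair.

Section HolomorphicSinhc.
Context {C : numClosedFieldType}.

(** The order of a closed field is partial, so common bounds replace minima. *)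
Lemma pos_lower_bound (x y : C) : 0 < x -> 0 < y -> exists d, [/\ 0 < d, d <= x & d <= y].
Proof.
move=> x0 y0.
have [xy|yx] := real_leP (gtr0_real x0) (gtr0_real y0); first by exists x.
by exists y; split=> //; exact: ltW.
Qed.

Lemma cvg_dnbhs0 (g : C -> C) L :
  (forall e : C, 0 < e -> exists2 d : C, 0 < d & forall h, h != 0 -> `|h| <= d -> `|g h - L| <= e) ->
  g @ (0 : C)^' --> L.
Proof.
move=> hg; apply/cvgrPdist_le => e e0; have [d d0 hd] := hg e e0.
have := @dnbhs0_le C C d d0; apply: filterS2 (nbhs_dnbhs_neq (0 : C)) => h h0 hh.
by rewrite distrC; exact: hd.
Qed.

Lemma differentiable_quotient (f : C -> C) x L :
  (forall e : C, 0 < e -> exists2 d : C, 0 < d &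
     forall h, h != 0 -> `|h| <= d -> `|h^-1 * (f (x + h) - f x) - L| <= e) ->
  differentiable f x.
Proof.
move=> hf; apply/derivable1_diffP; apply/cvg_ex; exists L.
apply: cvg_dnbhs0 => e e0; have [d d0 hd] := hf e e0; exists d => // h h0 hh.
rewrite /= (_ : h *: (1 : C) + x = x + h); first exact: hd.
by rewrite addrC -[h *: _]/(h * 1) mulr1.
Qed.

Variable E : C -> C.
Hypothesis ED : forall u v, E (u + v) = E u * E v.
Variables (r M : C).
Hypotheses (r0 : 0 < r) (M0 : 0 <= M).
Hypothesis Equad : forall h, `|h| <= r -> `|E h - 1 - h| <= M * `|h| ^+ 2.
Hypothesis arch : forall x e : C, 0 <= x -> 0 < e -> exists N : nat, x <= e * 2 ^+ N.

Lemma exp_law0 : E 0 = 1.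
Proof.
have := Equad (h := 0); rewrite normr0 expr0n mulr0 subr0 normr_le0 subr_eq0 => h.
by apply/eqP/h/ltW.
Qed.

Lemma exp_lawNK w : E w * E (- w) = 1. Proof. by rewrite -ED subrr exp_law0. Qed.

Lemma entire_exp_law : entire E.
Proof.
move=> w; apply: (@differentiable_quotient _ _ (E w)) => e e0.
have D0 : 0 < `|E w| * M + 1 by rewrite ltr_wpDl // mulr_ge0.
have [d [d0 dr de]] := pos_lower_bound r0 (divr_gt0 e0 D0).
exists d => // h h0 hd; have hr := le_trans hd dr; have he := le_trans hd de.
have nh : `|h| != 0 by rewrite normr_eq0.
have -> : h^-1 * (E (w + h) - E w) - E w = E w * h^-1 * (E h - 1 - h).
  by rewrite ED; field.
rewrite !normrM normfV.
apply: (@le_trans _ _ (`|E w| * `|h|^-1 * (M * `|h| ^+ 2))).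
  by apply: ler_wpM2l (Equad hr); rewrite mulr_ge0 // invr_ge0.
have -> : `|E w| * `|h|^-1 * (M * `|h| ^+ 2) = `|E w| * M * `|h| by field.
apply: (@le_trans _ _ ((`|E w| * M + 1) * `|h|)).
  by apply: ler_wpM2r => //; rewrite lerDl.
by rewrite mulrC -ler_pdivlMr.
Qed.

Definition sinh_quotient (w : C) : C := (E w - E (- w)) / (2 * w).

(** The value does not depend on the choice of the square root because sinh(w) / w
is even. *)
Definition sinhc (u : C) : C := if u == 0 then 1 else sinh_quotient (sqrtC u).

Lemma sinh_quotientN w : sinh_quotient (- w) = sinh_quotient w.
Proof. by rewrite /sinh_quotient opprK mulrN invrN mulrN -mulNr opprB. Qed.

Lemma sinhc_sqr w : w != 0 -> sinhc (w ^+ 2) = sinh_quotient w.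
Proof.
move=> w0; rewrite /sinhc expf_eq0 (negbTE w0) andbF.
have /eqP := sqrtCK (w ^+ 2); rewrite eqf_sqr => /orP[/eqP->//|/eqP->].
exact: sinh_quotientN.
Qed.

Lemma sinhcE w : 2 * (w * sinhc (w ^+ 2)) = E w - E (- w).
Proof.
have [->|w0] := eqVneq w 0; first by rewrite mul0r mulr0 oppr0 subrr.
by rewrite sinhc_sqr // /sinh_quotient; field.
Qed.

Lemma sinhc0 : sinhc 0 = 1. Proof. by rewrite /sinhc eqxx. Qed.

Lemma sinh_quotient_diff w : w != 0 -> differentiable sinh_quotient w.
Proof.
move=> w0; apply: differentiableM.
  apply: differentiableB; first exact: entire_exp_law.
  apply: (@differentiable_comp _ _ _ _ (fun z : C => - z) E); last exact: entire_exp_law.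
  exact: (entireN (@entire_id _ _)).
apply: differentiableV; last by rewrite mulf_neq0 // pnatr_eq0.
apply: (@entireM _ _ (fun=> 2) id); [exact: entire_cst | exact: entire_id].
Qed.

(** A branch of the square root around w0^2. *)
Definition near_root (w0 u : C) : C :=
  if `|sqrtC u - w0| <= `|sqrtC u + w0| then sqrtC u else - sqrtC u.

Lemma near_rootP w0 u : near_root w0 u ^+ 2 = u /\
  `|near_root w0 u - w0| <= `|near_root w0 u + w0|.
Proof.
rewrite /near_root; case: ifPn => h; first by rewrite sqrtCK.
rewrite sqrrN sqrtCK; split=> //.
rewrite -opprD normrN addrC [- _ + _]addrC distrC.
by rewrite [w0 + _]addrC; move: h; rewrite -real_ltNge ?normr_real // => /ltW.
Qed.

(** For z the root of w0^2 + h nearest to w0, h = (z - w0)(z + w0) and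
|w0| <= |z + w0|. Hence |z - w0|^2 <= |h|, so z tends to w0, and the difference
quotient 1 / (z + w0) tends to 1 / (2 w0). *)
Lemma near_root_diff w0 : w0 != 0 -> near_root w0 (w0 ^+ 2) = w0 /\
  differentiable (near_root w0) (w0 ^+ 2).
Proof.
move=> w00.
have sumn0 u : `|w0| <= `|near_root w0 u + w0|.
  have [_ h] := near_rootP w0 u; set z := near_root w0 u in h *.
  have p2 : 0 < 2 :> C by rewrite ltr0n.
  rewrite -(ler_pM2l p2) -{1}(ger0_norm (ltW p2)) -normrM.
  have -> : 2 * w0 = (z + w0) - (z - w0) by ring.
  apply: le_trans (ler_normB _ _) _; rewrite mulr_natl mulr2n.
  exact: lerD.
(* The other root - w0 would contradict the lower bound on |near_root + w0|. *)
have eqw : near_root w0 (w0 ^+ 2) = w0.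
  have [/eqP] := near_rootP w0 (w0 ^+ 2); rewrite eqf_sqr => /orP[/eqP //|/eqP h] _.
  by have := sumn0 (w0 ^+ 2); rewrite h addNr normr0 normr_le0 (negbTE w00).
split=> //; apply: (@differentiable_quotient _ _ ((2 * w0)^-1)) => e e0.
pose eta := 2 * `|w0| ^+ 2 * e.
have nw : 0 < `|w0| by rewrite normr_gt0.
have eta0 : 0 < eta by rewrite !mulr_gt0 // exprn_gt0.
exists (eta ^+ 2); first by rewrite exprn_gt0.
move=> h h0 hh; rewrite eqw.
have [z2 zle] := near_rootP w0 (w0 ^+ 2 + h); have zs := sumn0 (w0 ^+ 2 + h).
set z := near_root w0 _ in z2 zle zs *.
have hE : h = (z - w0) * (z + w0).
  by transitivity (z ^+ 2 - w0 ^+ 2); [rewrite z2; ring | ring].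
have zw : z + w0 != 0 by rewrite -normr_gt0 (lt_le_trans nw).
have zw' : z - w0 != 0 by apply: contraNneq h0 => e1; rewrite hE e1 mul0r.
have small : `|z - w0| <= eta.
  rewrite -(@ler_pXn2r _ 2) ?nnegrE ?normr_ge0 ?(ltW eta0) //.
  apply: le_trans hh; rewrite hE normrM expr2.
  by apply: ler_wpM2l zle.
have -> : h^-1 * (z - w0) - (2 * w0)^-1 = (w0 - z) / ((z + w0) * (2 * w0)).
  by rewrite hE; field; rewrite ?zw ?zw' ?w00.
rewrite normrM normfV distrC !normrM [`|2|]ger0_norm ?ler0n // ler_pdivrMr; last first.
  by rewrite !mulr_gt0 // (lt_le_trans nw).
apply: le_trans small _; rewrite /eta.
have -> : 2 * `|w0| ^+ 2 * e = e * (`|w0| * (2 * `|w0|)) by ring.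
apply: ler_wpM2l; first exact: ltW.
by apply: ler_wpM2r zs; rewrite mulr_ge0 // ler0n.
Qed.

(** Locally this is sinh(w) / w composed with a branch of the square root. *)
Lemma sinhc_diff_neq0 u : u != 0 -> differentiable sinhc u.
Proof.
move=> u0; have hu := sqrtCK u; set w0 := sqrtC u in hu.
have w00 : w0 != 0 by apply: contraNneq u0 => e; rewrite -hu e expr0n.
have [eqw dr] := near_root_diff w00; rewrite hu in eqw dr.
have dc : differentiable (sinh_quotient \o near_root w0) u.
  by apply: differentiable_comp dr _; rewrite eqw; exact: sinh_quotient_diff.
apply/derivable1_diffP; move/derivable1_diffP: dc.
apply: near_eq_derivable.
have : \forall z \near u, z != 0 by apply: (diff_near_neq0 (f := id)) u0; exact: entire_id.
apply: filterS => z z0 /=.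
have [z2 _] := near_rootP w0 z.
rewrite -{2}z2 sinhc_sqr //; apply: contraNneq z0 => e; rewrite -z2 e expr0n //.
Qed.

(** sinh w = 2 sinh(w/2) cosh(w/2) and cosh(w/2) = 1 + 2 sinh(w/4)^2. *)
Lemma sinhc_double w : sinhc (w ^+ 2) = sinhc ((w / 2) ^+ 2) * (1 + w ^+ 2 / 8 * sinhc ((w / 4) ^+ 2) ^+ 2).
Proof.
have [->|w0] := eqVneq w 0; first by rewrite !mul0r expr0n /= sinhc0 !mul0r addr0 mulr1.
have w20 : w / 2 != 0 by rewrite mulf_neq0 // invr_eq0 pnatr_eq0.
have w40 : w / 4 != 0 by rewrite mulf_neq0 // invr_eq0 pnatr_eq0.
rewrite !sinhc_sqr // /sinh_quotient.
have h := exp_lawNK (w / 4).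
have -> : E w = E (w / 4) ^+ 4.
  by rewrite -[4%N]/(2 * 2)%N exprM !expr2 -!ED; congr E; field.
have -> : E (- w) = E (- (w / 4)) ^+ 4.
  by rewrite -[4%N]/(2 * 2)%N exprM !expr2 -!ED; congr E; field.
have -> : E (w / 2) = E (w / 4) ^+ 2 by rewrite expr2 -ED; congr E; field.
have -> : E (- (w / 2)) = E (- (w / 4)) ^+ 2 by rewrite expr2 -ED; congr E; field.
move: (E (w / 4)) (E (- (w / 4))) h => e f ef.
transitivity ((e ^+ 2 - f ^+ 2) / w * ((e ^+ 2 + f ^+ 2) / 2)); first by field.
transitivity ((e ^+ 2 - f ^+ 2) / w * (1 + (e ^+ 2 + f ^+ 2 - 2) / 2)); first by field.
transitivity ((e ^+ 2 - f ^+ 2) / w * (1 + (e ^+ 2 + f ^+ 2 - 2 * (e * f)) / 2)); first by rewrite ef; field.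
by field.
Qed.

Lemma sinhc_lin w : `|w| <= r -> `|sinhc (w ^+ 2) - 1| <= M * `|w|.
Proof.
move=> hw; have [->|w0] := eqVneq w 0.
  by rewrite expr0n sinhc0 subrr !normr0 mulr0.
rewrite sinhc_sqr //.
have nw : 0 < `|w| by rewrite normr_gt0.
have -> : sinh_quotient w - 1 = ((E w - 1 - w) - (E (- w) - 1 - - w)) / (2 * w).
  by rewrite /sinh_quotient; field.
rewrite normrM normfV normrM [`|2|]ger0_norm ?ler0n // ler_pdivrMr ?mulr_gt0 //.
apply: le_trans (ler_normB _ _) _.
have h1 := Equad hw; have h2 : `|E (- w) - 1 - - w| <= M * `|w| ^+ 2.
  by rewrite -(normrN w); apply: Equad; rewrite normrN.
have -> : M * `|w| * (2 * `|w|) = M * `|w| ^+ 2 + M * `|w| ^+ 2 by ring.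
exact: lerD.
Qed.

(** The duplication formula compares the remainder at w with the remainder at w/2
up to M |w|^3. Iterating gives a geometric series with sum at most 2 M |w|^3, and
the remainder at w / 2^N tends to 0 because of the linear bound. Thus the
third-order behaviour of sinh follows from the second-order bound on E. *)
Lemma sinhc_quad w : `|w| <= r -> `|w| <= 1 -> M * `|w| <= 1 ->
  `|sinhc (w ^+ 2) - 1 - w ^+ 2 / 6| <= 2 * M * `|w| ^+ 3.
Proof.
pose h (z : C) := `|sinhc (z ^+ 2) - 1 - z ^+ 2 / 6|.
have half (z : C) : `|z / 2| <= `|z|.
  rewrite normrM [`|2^-1|]ger0_norm ?invr_ge0 ?ler0n //; apply: ler_piMr => //.
  by rewrite invf_le1 ?ler1n.
have quarter (z : C) : `|z / 4| <= `|z|.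
  rewrite normrM [`|4^-1|]ger0_norm ?invr_ge0 ?ler0n //; apply: ler_piMr => //.
  by rewrite invf_le1 ?ler1n.
have step (z : C) : `|z| <= r -> M * `|z| <= 1 -> h z <= h (z / 2) + M * `|z| ^+ 3.
  move=> zr zM.
  have hx : `|sinhc ((z / 2) ^+ 2) - 1| <= M * `|z|.
    by apply: le_trans (sinhc_lin (le_trans (half z) zr)) _; apply: ler_wpM2l.
  have hy : `|sinhc ((z / 4) ^+ 2) - 1| <= M * `|z|.
    by apply: le_trans (sinhc_lin (le_trans (quarter z) zr)) _; apply: ler_wpM2l.
  rewrite /h sinhc_double; move: (sinhc ((z / 2) ^+ 2)) (sinhc ((z / 4) ^+ 2)) hx hy => x y hx hy.
  have -> : x * (1 + z ^+ 2 / 8 * y ^+ 2) - 1 - z ^+ 2 / 6 =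
     (x - 1 - (z / 2) ^+ 2 / 6) + z ^+ 2 / 8 * ((x - 1) * y ^+ 2 + (y - 1) * (y + 1)).
    by field.
  apply: le_trans (ler_normD _ _) _; rewrite lerD2l.
  have y2 : `|y| <= 2.
    have -> : y = (y - 1) + 1 by ring.
    apply: le_trans (ler_normD _ _) _; rewrite normr1 -[2]/(1 + 1) lerD2r.
    exact: le_trans hy zM.
  have y3 : `|y + 1| <= 3.
    apply: le_trans (ler_normD _ _) _; have -> : 3 = 2 + 1 :> C by ring.
    by rewrite normr1 lerD2r.
  have Mz : 0 <= M * `|z| by rewrite mulr_ge0.
  have b : `|(x - 1) * y ^+ 2 + (y - 1) * (y + 1)| <= 8 * (M * `|z|).
    apply: le_trans (ler_normD _ _) _.
    have -> : 8 * (M * `|z|) = M * `|z| * 4 + M * `|z| * 4 by ring.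
    apply: lerD.
      rewrite (normrM (x - 1)); apply: ler_pM; [exact: normr_ge0|exact: normr_ge0|exact: hx|].
      have -> : 4 = 2 ^+ 2 :> C by ring.
      by rewrite normrX ler_pXn2r ?nnegrE ?normr_ge0 ?ler0n.
    rewrite (normrM (y - 1)); apply: ler_pM; [exact: normr_ge0|exact: normr_ge0|exact: hy|].
    by apply: le_trans y3 _; rewrite ler_nat.
  rewrite normrM normrM normrX [`|8^-1|]ger0_norm ?invr_ge0 ?ler0n //.
  have -> : M * `|z| ^+ 3 = `|z| ^+ 2 / 8 * (8 * (M * `|z|)) by field.
  by apply: ler_wpM2l b; rewrite divr_ge0 ?ler0n // exprn_ge0.
have iter N : forall z : C, `|z| <= r -> M * `|z| <= 1 -> h z <= h (z / 2 ^+ N) + 2 * M * `|z| ^+ 3.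
  elim: N => [|N IH] z zr zM.
    by rewrite expr0 divr1 lerDl !mulr_ge0 ?ler0n // exprn_ge0.
  apply: le_trans (step z zr zM) _.
  have zr' := le_trans (half z) zr.
  have zM' : M * `|z / 2| <= 1 by apply: le_trans zM; apply: ler_wpM2l.
  have := IH _ zr' zM'; rewrite -mulrA -invfM -exprS => hh.
  apply: le_trans (lerD hh (lexx _)) _; rewrite -addrA lerD2l.
  rewrite normrM [`|2^-1|]ger0_norm ?invr_ge0 ?ler0n //.
  have -> : 2 * M * (`|z| / 2) ^+ 3 + M * `|z| ^+ 3 = (5 / 4) * (M * `|z| ^+ 3) by field.
  rewrite -[2 * M * _]mulrA; apply: ler_wpM2r; first by rewrite mulr_ge0 ?exprn_ge0.
  by rewrite ler_pdivrMr ?ltr0n // -natrM ler_nat.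
move=> wr w1 wM; apply/ler_addgt0Pr => e e0.
have [N hN] := arch (x := (M + 1) * `|w|) (mulr_ge0 (addr_ge0 M0 ler01) (normr_ge0 w)) e0.
apply: le_trans (iter N w wr wM) _; rewrite addrC lerD2l.
have p2 : 0 < 2 ^+ N :> C by rewrite exprn_gt0 ?ltr0n.
have wN : `|w / 2 ^+ N| <= `|w|.
  rewrite normrM [`|(2 ^+ N)^-1|]ger0_norm ?invr_ge0 ?(ltW p2) //; apply: ler_piMr => //.
  by rewrite invf_le1 // exprn_ege1 // ler1n.
apply: (@le_trans _ _ ((M + 1) * `|w / 2 ^+ N|)).
  rewrite /h; apply: le_trans (ler_normB _ _) _; rewrite mulrDl mul1r; apply: lerD.
    exact: sinhc_lin (le_trans wN wr).
  rewrite normrM normrX [`|6^-1|]ger0_norm ?invr_ge0 ?ler0n // expr2 -mulrA.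
  apply: ler_piMr => //; apply: mulr_ile1 => //; rewrite ?invr_ge0 ?ler0n //.
    exact: le_trans wN w1.
  by rewrite invf_le1 ?ler1n ?ltr0n.
by rewrite normrM [`|(2 ^+ N)^-1|]ger0_norm ?invr_ge0 ?(ltW p2) // mulrA ler_pdivrMr.
Qed.

(** The derivative at 0 is 1/6: with u = w^2, the previous estimate bounds the error
of the difference quotient by 2 M |w|. *)
Lemma sinhc_diff0 : differentiable sinhc 0.
Proof.
apply: (@differentiable_quotient _ _ (1 / 6)) => e e0.
have D0 : 0 < 2 * M + 1 by rewrite ltr_wpDl // mulr_ge0 ?ler0n.
have D1 : 0 < M + 1 by rewrite ltr_wpDl.
have [d1 [d10 d1r d1M]] := pos_lower_bound r0 (divr_gt0 ltr01 D1).
have [d2 [d20 d21 d2e]] := pos_lower_bound ltr01 (divr_gt0 e0 D0).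
have [d [d0 dd1 dd2]] := pos_lower_bound d10 d20.
exists (d ^+ 2); first by rewrite exprn_gt0.
move=> h h0 hh; rewrite add0r sinhc0.
have hw := sqrtCK h; set w := sqrtC h in hw.
have w0 : w != 0 by apply: contraNneq h0 => w0; rewrite -hw w0 expr0n.
have wd : `|w| <= d.
  rewrite -(@ler_pXn2r _ 2) ?nnegrE ?normr_ge0 ?(ltW d0) //.
  by rewrite -normrX hw.
have nw : 0 < `|w| by rewrite normr_gt0.
have wd1 := le_trans wd dd1; have wd2 := le_trans wd dd2.
have wr := le_trans wd1 d1r; have wM := le_trans wd1 d1M.
have w1 := le_trans wd2 d21; have we := le_trans wd2 d2e.
have wM' : M * `|w| <= 1.
  rewrite mulrC; apply: (@le_trans _ _ (`|w| * (M + 1))).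
    by apply: ler_wpM2l => //; rewrite lerDl.
  by rewrite -ler_pdivlMr.
have hq := sinhc_quad wr w1 wM'; rewrite -hw.
have -> : (w ^+ 2)^-1 * (sinhc (w ^+ 2) - 1) - 1 / 6 = (w ^+ 2)^-1 * (sinhc (w ^+ 2) - 1 - w ^+ 2 / 6).
  by field.
rewrite normrM normfV normrX mulrC ler_pdivrMr ?exprn_gt0 //.
apply: le_trans hq _.
have -> : 2 * M * `|w| ^+ 3 = 2 * M * `|w| * `|w| ^+ 2 by ring.
apply: ler_wpM2r; first by rewrite exprn_ge0.
apply: (@le_trans _ _ (`|w| * (2 * M + 1))).
  by rewrite mulrC; apply: ler_wpM2l => //; rewrite lerDl.
by rewrite -ler_pdivlMr.
Qed.

Lemma sinhc_exp_pair : (forall l, l != 0 -> exists w, E w = l) -> exp_pair E sinhc.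
Proof.
move=> hs; split=> //.
- split; first exact: entire_exp_law.
  by move=> u; have [->|u0] := eqVneq u 0; [exact: sinhc_diff0 | exact: sinhc_diff_neq0].
- exact: sinhc0.
- exact: sinhcE.
Qed.
End HolomorphicSinhc.

Section RealBounds.
Context {R : realType}.
Implicit Types x y : R.

Lemma norm_sin_le y : `|sin y| <= `|y|.
Proof.
wlog y0 : y / 0 < y.
  move=> h; have [y0|y0|<-] := ltrgtP 0 y; first exact: h.
    by rewrite -(normrN (sin y)) -sinN -(normrN y); apply: h; rewrite oppr_gt0.
  by rewrite sin0 normr0.
have [|c _ e] := MVT y0 (fun x _ => is_derive_sin x).
  by apply: continuous_subspaceT => x; exact: continuous_sin.
move: e; rewrite sin0 !subr0 => ->; rewrite normrM; apply: ler_piMl => //; exact: cos_max.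
Qed.

(** cos y - 1 = - 2 sin(y/2)^2. *)
Lemma norm_cosB1_le y : `|cos y - 1| <= y ^+ 2.
Proof.
have -> : cos y - 1 = - (2 * sin (y / 2) ^+ 2).
  have {1}-> : y = (y / 2) *+ 2 by rewrite -mulr_natr; field.
  by rewrite cos_mulr2n cos2sin2 -mulr_natr; ring.
rewrite normrN normrM normrX ger0_norm // -(real_normK (num_real y)).
have h := norm_sin_le (y / 2).
have h2 : `|sin (y / 2)| ^+ 2 <= `|y / 2| ^+ 2 by rewrite ler_pXn2r ?nnegrE.
apply: (@le_trans _ _ (2 * `|y / 2| ^+ 2)); first by rewrite ler_pM2l.
rewrite normrM [`|2^-1|]ger0_norm ?invr_ge0 ?ler0n // exprMn.
have -> : 2 * (`|y| ^+ 2 * 2^-1 ^+ 2) = `|y| ^+ 2 * 2^-1 by field.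
by apply: ler_piMr; [exact: exprn_ge0 | rewrite invf_le1 ?ler1n].
Qed.

(** Mean value theorem for sin y - y, whose derivative at c is at most c^2 <= y in
absolute value when 0 < c < y <= 1. *)
Lemma norm_sinB_le y : `|y| <= 1 -> `|sin y - y| <= y ^+ 2.
Proof.
wlog y0 : y / 0 < y.
  move=> h y1; have [y0|y0|<-] := ltrgtP 0 y; first exact: h.
    rewrite -normrN opprB addrC -sinN -sqrrN.
    have := h (- y); rewrite opprK normrN oppr_gt0; exact.
  by rewrite sin0 subrr normr0 sqr_ge0.
rewrite gtr0_norm // => y1.
have hd (x : R) : x \in `]0, y[ -> is_derive x 1 (fun x => sin x - x) (cos x - 1).
  by move=> _; exact: is_deriveB.
have hc : {within `[0, y], continuous (fun x : R => sin x - x)}.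
  apply: continuous_subspaceT => x; apply: continuousB; first exact: continuous_sin.
  exact: cvg_id.
have [c] := MVT y0 hd hc.
rewrite in_itv /= => /andP[c0 cy]; rewrite sin0 !subr0 => ->.
rewrite normrM (gtr0_norm y0) expr2 ler_pM2r //.
apply: le_trans (norm_cosB1_le c) _; rewrite expr2.
apply: (@le_trans _ _ c); last exact: ltW.
by apply: ler_piMl; [exact: ltW | exact: ltW (lt_le_trans cy y1)].
Qed.

(** The upper bound comes from 1 - x <= exp(- x). *)
Lemma expR_quad x : `|x| <= 1 / 2 -> 0 <= expR x - 1 - x <= 2 * x ^+ 2.
Proof.
rewrite ler_norml => /andP[x1 x2].
apply/andP; split; first by have := expR_ge1Dx x; lra.
have h := expR_ge1Dx (- x); rewrite expRN in h.
have e0 := expR_gt0 x.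
have h' : (1 - x) * expR x <= 1 by rewrite -ler_pdivlMr // mul1r.
suff : expR x <= 1 + x + 2 * x ^+ 2 by lra.
have x0 : 0 < 1 - x by lra.
rewrite -(ler_pM2l x0); apply: le_trans h' _.
have -> : (1 - x) * (1 + x + 2 * x ^+ 2) = 1 + x ^+ 2 * (1 - 2 * x) by ring.
by rewrite lerDl mulr_ge0 ?sqr_ge0 //; lra.
Qed.

Lemma exp_cos_bound x y : `|x| <= 1 / 2 -> `|y| <= 1 / 2 ->
  `|expR x * cos y - 1 - x| <= 2 * (x ^+ 2 + y ^+ 2) /\
  `|expR x * sin y - y| <= 3 * (x ^+ 2 + y ^+ 2).
Proof.
move=> hx hy; have /andP[e1 e2] := expR_quad hx.
have x2 : x ^+ 2 <= 1 / 4.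
  rewrite -(real_normK (num_real x)); have -> : 1 / 4 = (1 / 2) ^+ 2 :> R by field.
  by rewrite ler_pXn2r ?nnegrE //; lra.
have eb : `|expR x| <= 2.
  rewrite gtr0_norm ?expR_gt0 //; move: hx; rewrite ler_norml => /andP[_ hx]; lra.
have hc := norm_cosB1_le y.
have hs : `|sin y - y| <= y ^+ 2 by apply: norm_sinB_le; lra.
split.
  have -> : expR x * cos y - 1 - x = expR x * (cos y - 1) + (expR x - 1 - x) by ring.
  have -> : 2 * (x ^+ 2 + y ^+ 2) = 2 * y ^+ 2 + 2 * x ^+ 2 by ring.
  apply: le_trans (ler_normD _ _) _; apply: lerD; last by rewrite ger0_norm.
  by rewrite normrM; apply: ler_pM.
have -> : expR x * sin y - y = expR x * (sin y - y) + (expR x - 1) * y by ring.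
apply: le_trans (ler_normD _ _) _.
apply: (@le_trans _ _ (2 * y ^+ 2 + 2 * `|x| * `|y|)).
  apply: lerD; first by rewrite normrM; apply: ler_pM.
  rewrite normrM; apply: ler_wpM2r => //.
  have -> : expR x - 1 = (expR x - 1 - x) + x by ring.
  apply: le_trans (ler_normD _ _) _; rewrite ger0_norm //.
  have : 2 * x ^+ 2 <= `|x|; last by lra.
  rewrite -(real_normK (num_real x)); have := normr_ge0 x; nra.
rewrite -(real_normK (num_real x)) -(real_normK (num_real y)).
have := sqr_ge0 (`|x| - `|y|); nra.
Qed.

(** The angle is plus or minus the arc cosine of x / r, according to the sign of y. *)
Lemma polar_form x y : (x != 0) || (y != 0) ->
  exists s t, expR s * cos t = x /\ expR s * sin t = y.
Proof.
move=> xy; pose r := Num.sqrt (x ^+ 2 + y ^+ 2).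
have n0 : 0 < x ^+ 2 + y ^+ 2.
  rewrite lt_def addr_ge0 ?sqr_ge0 // andbT paddr_eq0 ?sqr_ge0 // !sqrf_eq0.
  by rewrite negb_and.
have r0 : 0 < r by rewrite sqrtr_gt0.
have r2 : r ^+ 2 = x ^+ 2 + y ^+ 2 by rewrite sqr_sqrtr // ltW.
have er : expR (ln r) = r by rewrite lnK.
have nxr : (x / r) ^+ 2 <= 1.
  by rewrite expr_div_n ler_pdivrMr ?exprn_gt0 // mul1r r2 lerDl sqr_ge0.
have xr : -1 <= x / r <= 1.
  by rewrite -ler_norml -(@ler_pXn2r _ 2) ?nnegrE // expr1n real_normK ?num_real.
have c1 : cos (acos (x / r)) = x / r by apply: acosK; rewrite in_itv.
have s1 : sin (acos (x / r)) = `|y| / r.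
  have -> : `|y| / r = `|y / r| by rewrite normrM normfV (gtr0_norm r0).
  rewrite sin_acos // -sqrtr_sqr.
  congr Num.sqrt; rewrite !expr_div_n r2; field.
  by rewrite lt0r_neq0.
have rn : r != 0 by rewrite lt0r_neq0.
have [y0|y0] := leP 0 y.
  exists (ln r), (acos (x / r)); rewrite er c1 s1 ger0_norm //.
  by split; rewrite mulrC divfK.
exists (ln r), (- acos (x / r)); rewrite er cosN sinN c1 s1 ltr0_norm //.
by split; rewrite mulrC; [rewrite divfK | rewrite !mulNr opprK divfK].
Qed.
End RealBounds.

Section ComplexExp.
Context {R : realType}.
Local Notation C := (complex R).

Definition cexp (z : C) : C :=
  Complex (expR (complex.Re z) * cos (complex.Im z)) (expR (complex.Re z) * sin (complex.Im z)).

Lemma cexpD u v : cexp (u + v) = cexp u * cexp v.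
Proof.
case: u v => [a b] [c d]; apply/eqP; rewrite eq_complex /= expRD cosD sinD.
by apply/andP; split; apply/eqP; ring.
Qed.

Lemma cexp_surj l : l != 0 -> exists w, cexp w = l.
Proof.
case: l => x y; rewrite eq_complex /= negb_and => /polar_form[s [t [h1 h2]]].
by exists (Complex s t); rewrite /cexp /= h1 h2.
Qed.

Lemma cexp_quad (h : C) : `|h| <= 1 / 2 -> `|cexp h - 1 - h| <= 5 * `|h| ^+ 2.
Proof.
case: h => x y hh.
have hr : Num.sqrt (x ^+ 2 + y ^+ 2) <= 1 / 2 :> R.
  move: hh; rewrite normc_def /=.
  have -> : 1 / 2 = (1 / 2 : R)%:C%C :> C by rewrite rmorphM /= fmorphV rmorph1 rmorph_nat.
  by rewrite lecR.
have hx : `|x| <= 1 / 2.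
  by apply: le_trans hr; rewrite -sqrtr_sqr ler_wsqrtr // lerDl sqr_ge0.
have hy : `|y| <= 1 / 2.
  by apply: le_trans hr; rewrite -(sqrtr_sqr y) ler_wsqrtr // lerDr sqr_ge0.
have [h1 h2] := exp_cos_bound hx hy.
rewrite -add_Re2_Im2 /= normc_def /=.
have -> : 5 = (5 : R)%:C%C :> C by rewrite rmorph_nat.
rewrite -rmorphM lecR subr0.
set u := expR x * cos y - 1 - x in h1 *; set v := expR x * sin y - y in h2 *.
apply: (@le_trans _ _ (`|u| + `|v|)).
  rewrite -(@ler_pXn2r _ 2) ?nnegrE ?sqrtr_ge0 ?addr_ge0 // sqr_sqrtr ?addr_ge0 ?sqr_ge0 //.
  rewrite -(real_normK (num_real u)) -(real_normK (num_real v)).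
  have := mulr_ge0 (normr_ge0 u) (normr_ge0 v); nra.
lra.
Qed.

Lemma complex_arch (x e : C) : 0 <= x -> 0 < e -> exists N : nat, x <= e * 2 ^+ N.
Proof.
case: x e => [x x'] [e e']; rewrite lecE ltcE /= => /andP[/eqP -> x0] /andP[/eqP -> e0].
exists (Num.bound (x / e)).
have -> : (2 : C) ^+ Num.bound (x / e) = ((2 : R) ^+ Num.bound (x / e))%:C%C.
  by rewrite rmorphXn rmorph_nat.
rewrite -[Complex x 0]/(x%:C%C) -[Complex e 0]/(e%:C%C) -rmorphM lecR.
rewrite mulrC -ler_pdivrMr //; apply: ltW.
exact: upper_nthrootP.
Qed.
End ComplexExp.

Lemma exp_pair_exists (R : realType) : exists E S : Cplx R -> Cplx R, exp_pair E S.
Proof.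
exists (cexp : Cplx R -> Cplx R), (sinhc (cexp : Cplx R -> Cplx R)).
apply: (@sinhc_exp_pair (Cplx R) cexp (@cexpD R) (1 / 2) 5).
- by rewrite divr_gt0.
- by [].
- exact: cexp_quad.
- exact: complex_arch.
- exact: cexp_surj.
Qed.

(** * Ambient symmetries of the hypersurface and their orbits *)

Section Orbits.
Context {C : numClosedFieldType} {n : nat}.
Local Notation V := 'rV[C]_n.+3.
Variables a b : mpoly n.+1 C.
Local Notation X := (hypersurface a b).
Local Notation P := (defining_fun a b).

Lemma hypersurfaceE p : X p <-> P p = 0.
Proof.
rewrite /hypersurface /defining_fun /=; split => [->|/eqP]; first by rewrite subrr.
by rewrite subr_eq0 => /eqP.
Qed.

(** Invariance is required of the polynomial P on the whole ambient space, which is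
what the residue argument for the volume form uses. *)
Definition unimodular_symmetry (phi : V -> V) : Prop :=
  (forall p, P (phi p) = P p) /\ unimodular phi.

(** One half of an automorphism: psi inverts phi on the left only, so that both
halves of an automorphism are instances of the same notion. The boolean vol
requests the volume-preserving case. *)
Definition entire_symmetry (vol : bool) (phi psi : V -> V) : Prop :=
  [/\ entire phi, {homo phi : p / X p}, forall p, X p -> psi (phi p) = p &
      vol -> unimodular_symmetry phi].

Definition same_orbit (vol : bool) (p q : V) : Prop :=
  exists phi psi, [/\ entire_symmetry vol phi psi, entire_symmetry vol psi phi & phi p = q].

Lemma unimodular_symmetry_homo phi : unimodular_symmetry phi -> {homo phi : p / X p}.
Proof. by move=> [h _] p /hypersurfaceE Xp; apply/hypersurfaceE; rewrite h. Qed.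

Lemma unimodular_symmetry_comp phi1 phi2 : entire phi1 -> entire phi2 ->
  unimodular_symmetry phi1 -> unimodular_symmetry phi2 -> unimodular_symmetry (phi2 \o phi1).
Proof.
move=> e1 e2 [h1 u1] [h2 u2]; split; first by move=> p; rewrite /= h2 h1.
exact: unimodular_comp.
Qed.

Lemma entire_symmetry_comp vol f1 g1 f2 g2 : entire_symmetry vol f1 g1 ->
  entire_symmetry vol f2 g2 -> entire_symmetry vol (f2 \o f1) (g1 \o g2).
Proof.
move=> [e1 X1 k1 s1] [e2 X2 k2 s2]; split.
- exact: entire_comp.
- by move=> p Xp; apply/X2/X1.
- by move=> p Xp /=; rewrite k2 ?k1//; exact: X1.
- by move=> v; apply: unimodular_symmetry_comp => //; [exact: s1|exact: s2].
Qed.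

Lemma same_orbit_sym vol p q : X p -> same_orbit vol p q -> same_orbit vol q p.
Proof.
move=> Xp [f [g [hf hg <-]]]; exists g, f; split=> //.
by case: hf => _ _ k _; exact: k.
Qed.

Lemma same_orbit_trans vol p q r :
  same_orbit vol p q -> same_orbit vol q r -> same_orbit vol p r.
Proof.
move=> [f1 [g1 [hf1 hg1 <-]]] [f2 [g2 [hf2 hg2 <-]]].
exists (f2 \o f1), (g1 \o g2).
by split; [exact: (entire_symmetry_comp hf1 hf2) | exact: (entire_symmetry_comp hg2 hg1) |].
Qed.

Lemma same_orbit_mem vol p q : X p -> same_orbit vol p q -> X q.
Proof. by move=> Xp [f [g [[_ h _ _] _ <-]]]; exact: h. Qed.

Lemma entire_symmetry_Aut_hol vol f g : entire_symmetry vol f g -> entire_symmetry vol g f ->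
  Aut_hol X f.
Proof.
move=> [ef hf kf _] [eg hg kg _]; split=> //.
  by move=> p _; exists f; exact: entire_holo_extension.
by exists g; split=> // p _; exists g; exact: entire_holo_extension.
Qed.

End Orbits.

(** * Taylor expansion in one variable, and polynomials that vanish everywhere *)

Section Taylor.
Context {C : numClosedFieldType} {m : nat}.
Implicit Types (p : mpoly m.+1 C) (z : 'I_m.+1 -> C).

Definition shift_coord (i : 'I_m.+1) (s : C) z : 'I_m.+1 -> C :=
  fun j => z j + s * (j == i)%:R.

Lemma meval_monomial_shift i s z (e : multinom m.+1) : e i = 0%N ->
  meval (shift_coord i s z) (mpolyX C e) = meval z (mpolyX C e).
Proof.
move=> ei; rewrite !mevalX; apply: eq_bigr => j _.
by rewrite /shift_coord; case: eqP => [->|_]; rewrite ?ei ?expr0 // mulr0 addr0.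
Qed.

(** By linearity p may be taken to be a monomial, a power of z_i with exponent at
most 2 times a monomial free of z_i. *)
Lemma taylor2 i s z p : (degz i p <= 2)%N ->
  [/\ meval (shift_coord i s z) p =
        meval z p + s * meval z (mderiv i p) + s ^+ 2 / 2 * meval z (mderiv i (mderiv i p)),
      meval (shift_coord i s z) (mderiv i p) =
        meval z (mderiv i p) + s * meval z (mderiv i (mderiv i p)) &
      meval (shift_coord i s z) (mderiv i (mderiv i p)) = meval z (mderiv i (mderiv i p))].
Proof.
move=> dp.
pose Q q := [/\ meval (shift_coord i s z) q =
        meval z q + s * meval z (mderiv i q) + s ^+ 2 / 2 * meval z (mderiv i (mderiv i q)),
      meval (shift_coord i s z) (mderiv i q) =
        meval z (mderiv i q) + s * meval z (mderiv i (mderiv i q)) &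
      meval (shift_coord i s z) (mderiv i (mderiv i q)) = meval z (mderiv i (mderiv i q))].
rewrite -/(Q p) [p]mpolyE.
rewrite big_seq; elim/big_ind : _.
- by rewrite /Q !mderiv0 !meval0; split; ring.
- by move=> p1 p2 [a1 a2 a3] [b1 b2 b3]; rewrite /Q !mderivD !mevalD a1 a2 a3 b1 b2 b3; split; ring.
move=> e esupp.
have ei : (e i <= 2)%N.
  by apply: leq_trans dp; rewrite /degz (big_rem e) //= leq_maxl.
rewrite /Q !mderivZ !mevalZ.
suff [-> -> ->] : Q (mpolyX C e) by split; ring.
pose e' : multinom m.+1 := mnm_sub e (mnm_muln (mnm1 i) (e i)).
have e'i : e' i = 0%N by rewrite mnmBE mulmnE mnm1E eqxx mul1n subnn.
have M0 : mderiv i (mpolyX C e') = 0 by rewrite mderivX e'i scale0r.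
have D1 : mderiv i (mpolyX C (mnm1 i)) = 1.
  rewrite mderivX mnm1E eqxx scale1r -mpolyX0; congr mpolyX.
  by apply/mnmP => j; rewrite mnmBE subnn mnm0E.
have -> : mpolyX C e = mpolyX C (mnm1 i) ^+ e i * mpolyX C e'.
  rewrite mpolyXn -mpolyXD; congr mpolyX; apply/mnmP => j.
  rewrite mnmDE mnmBE mulmnE mnm1E.
  by case: eqP => [->|_]; rewrite ?mul1n ?mul0n ?subnn ?addn0 ?add0n ?subn0.
have Xi z' : meval z' (mpolyX C (mnm1 i)) = z' i by exact: mevalXU.
have Zi : shift_coord i s z i = z i + s by rewrite /shift_coord eqxx mulr1.
have Ms := meval_monomial_shift s z e'i.
set M := mpolyX C e' in M0 Ms *.
set Y := mpolyX C (mnm1 i) in D1 Xi *.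
have d1 : mderiv i 1 = 0 :> mpoly m.+1 C by rewrite -[1]/(mpolyC m.+1 1) mderivC.
case: (e i) ei => [|[|[|//]]] _.
- by rewrite /Q expr0 mul1r M0 mderiv0 !meval0 Ms; split; ring.
- rewrite /Q expr1 !mderivM M0 D1 mulr0 addr0 mul1r M0 !mevalM !meval0 Ms Xi Zi Xi.
  by split; ring.
rewrite /Q expr2 !(mderivM, mderivD, M0, D1, mulr0, addr0, mul1r, mulr1, d1, mul0r, add0r).
by rewrite !(mevalD, mevalM, Ms, Xi, Zi); split; field.
Qed.

Lemma mderiv2_degz1 i z p : (degz i p <= 1)%N -> meval z (mderiv i (mderiv i p)) = 0.
Proof.
move=> dp; rewrite [p]mpolyE.
rewrite big_seq; elim/big_ind : _.
- by rewrite !mderiv0 meval0.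
- by move=> p1 p2 h1 h2; rewrite !mderivD mevalD h1 h2 addr0.
move=> e esupp.
have ei : (e i <= 1)%N.
  by apply: leq_trans dp; rewrite /degz (big_rem e) //= leq_maxl.
rewrite !mderivZ mderivX mderivZ mderivX mnmBE mnm1E eqxx.
by case: (e i) ei => [|[|//]] _; rewrite ?scale0r ?scaler0 meval0.
Qed.
End Taylor.

Section Vanishing.
Context {C : numClosedFieldType} {n : nat}.
Implicit Types p : mpoly n.+1 C.

(** The analytic differential of the evaluation map is given by the formal
derivatives, and the evaluation map is constant. *)
Lemma meval_eq0_mderiv p i : (forall z, meval z p = 0) -> forall z, meval z (mderiv i p) = 0.
Proof.
move=> h z.
pose q : 'rV[C]_n.+3 := \row_j (if unlift ord0 j is Some j' then
  (if unlift ord0 j' is Some i then z i else 0) else 0).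
have zq : zcoord q = z by apply/funext => l; rewrite /zcoord /q mxE /iz !liftK.
have h1 := @diff_val _ _ _ _ _ _ _ (meval_is_diff p q).
have h0 := @diff_val _ _ _ _ _ _ _ (is_diff_cst (0 : C) q).
have e : (fun v : 'rV[C]_n.+3 => meval (zcoord v) p : C) = cst 0 by apply/funext => v; rewrite h.
rewrite e h0 in h1.
have := congr1 (fun f => f (delta_mx 0 (iz i))) h1.
rewrite /= zq (bigD1 i) //= big1 => [|j ji].
  by rewrite mxE !eqxx mulr1 addr0.
by rewrite mxE /iz !(inj_eq lift_inj) (negbTE ji) andbF mulr0.
Qed.

(** Every iterated formal derivative vanishes at 0, and up to a factorial these
values are the coefficients. *)
Lemma meval_eq0 p : (forall z, meval z p = 0) -> p = 0.
Proof.
move=> h; apply/mpolyP => e; rewrite mcoeff0.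
have hd s : forall p, (forall z, meval z p = 0) ->
    forall z, meval z (foldr (fun i => iter (e i) (mderiv i)) p s) = 0.
  elim: s => [|i s IH] //= q hq.
  by elim: (e i) => [|l IHl] /=; [exact: IH | exact: meval_eq0_mderiv].
have /(_ (fun=> 0)) := hd (enum 'I_n.+1) _ h.
rewrite -[foldr _ _ _]/(mderivm e p) => h0.
have c0 (q : mpoly n.+1 C) : meval (fun=> 0) q = mcoeff mnm0 q.
  rewrite mevalE [in RHS](mpolyE q) raddf_sum; apply: eq_bigr => l _ /=.
  rewrite mcoeffZ mcoeffX; congr (_ * _).
  have [->|l0] := eqVneq l mnm0; first by rewrite big1 // => i _; rewrite mnm0E expr0.
  have [i hi] : exists i, l i != 0%N.
    apply: contrapT => hn; move/negP: l0; apply; apply/eqP/mnmP => i.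
    by rewrite mnm0E; apply/eqP/negPn/negP => hi; apply: hn; exists i.
  by rewrite (bigD1 i) //= expr0n (negbTE hi) mul0r.
move: h0; rewrite c0 mcoeff_mderivm (_ : mnm_add e mnm0 = e); last first.
  by apply/mnmP => i; rewrite mnmDE mnm0E addn0.
move=> /eqP; rewrite mulrn_eq0 => /orP[|/eqP //].
by rewrite gtn_eqF // prodn_gt0 // => i; rewrite ffactnn fact_gt0.
Qed.
End Vanishing.

(** * The flows of the conic fields *)

Section Coordinates.
Context {C : numClosedFieldType} {n : nat}.
Local Notation V := 'rV[C]_n.+3.

Definition dirx : V := delta_mx 0 ix.
Definition diry : V := delta_mx 0 iy.
Definition dirz (i : 'I_n.+1) : V := delta_mx 0 (iz i).

Lemma add_dirx (p : V) h :
  [/\ (p + h *: dirx) 0 ix = p 0 ix + h, (p + h *: dirx) 0 iy = p 0 iy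
    & zcoord (p + h *: dirx) = zcoord p].
Proof.
split; [| |apply/funext => j]; rewrite /zcoord !mxE eqxx /=.
- by rewrite mulr1.
- by rewrite mulr0 addr0.
by rewrite mulr0 addr0.
Qed.

Lemma add_diry (p : V) h :
  [/\ (p + h *: diry) 0 ix = p 0 ix, (p + h *: diry) 0 iy = p 0 iy + h
    & zcoord (p + h *: diry) = zcoord p].
Proof.
split; [| |apply/funext => j]; rewrite /zcoord !mxE eqxx /=.
- by rewrite mulr0 addr0.
- by rewrite ?eqxx mulr1.
by rewrite mulr0 addr0.
Qed.

Lemma add_dirz (p : V) i h :
  [/\ (p + h *: dirz i) 0 ix = p 0 ix, (p + h *: dirz i) 0 iy = p 0 iy
    & zcoord (p + h *: dirz i) = shift_coord i h (zcoord p)].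
Proof.
split; [| |apply/funext => j]; rewrite /shift_coord /zcoord !mxE eqxx /=.
- by rewrite mulr0 addr0.
- by rewrite mulr0 addr0.
by rewrite /iz !(inj_eq lift_inj).
Qed.

Lemma add_dirx_dirz (p : V) i g h : let q := p + g *: dirx + h *: dirz i in
  [/\ q 0 ix = p 0 ix + g, q 0 iy = p 0 iy & zcoord q = shift_coord i h (zcoord p)].
Proof.
have [x1 y1 z1] := add_dirx p g; have [x2 y2 z2] := add_dirz (p + g *: dirx) i h.
by move=> q; rewrite /q; split; [rewrite x2 x1|rewrite y2 y1|rewrite z2 z1].
Qed.

Lemma entire_coord j : entire (fun p : V => p 0 j : C).
Proof. by move=> q; case: (coord_is_diff j q). Qed.

Lemma entire_meval (q : mpoly n.+1 C) : entire (fun p : V => meval (zcoord p) q : C).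
Proof. by move=> p; case: (meval_is_diff q p). Qed.

Lemma eq_coords (p q : V) : p 0 ix = q 0 ix -> p 0 iy = q 0 iy ->
  zcoord p = zcoord q -> p = q.
Proof.
move=> hx hy hz; apply/rowP => j.
case: (unliftP ord0 j) => [j' ->|-> //].
case: (unliftP ord0 j') => [i ->|-> //].
exact: (congr1 (fun f => f i) hz).
Qed.
End Coordinates.

Section ConicFlow.
Context {C : numClosedFieldType} {n : nat}.
Local Notation V := 'rV[C]_n.+3.
Variables (a b : mpoly n.+1 C) (i : 'I_n.+1).
Hypotheses (da : (degz i a <= 2)%N) (db : (degz i b <= 1)%N).

(** [velx] and [velz] are the components of the Hamiltonian field of P in the
(x, z_i)-plane; [accx] and [accz] are those of its linear part applied to this
velocity. *)
Definition velx (p : V) : C :=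
  meval (zcoord p) (mderiv i a) + p 0 ix * meval (zcoord p) (mderiv i b).
Definition velz (p : V) : C := 2 * p 0 ix * p 0 iy - meval (zcoord p) b.
Definition accx (p : V) : C :=
  meval (zcoord p) (mderiv i b) * velx p + meval (zcoord p) (mderiv i (mderiv i a)) * velz p.
Definition accz (p : V) : C :=
  2 * p 0 iy * velx p - meval (zcoord p) (mderiv i b) * velz p.

(** The square of the trace-free linear part of the field is this scalar. *)
Definition conic_disc (p : V) : C :=
  meval (zcoord p) (mderiv i b) ^+ 2 + 2 * p 0 iy * meval (zcoord p) (mderiv i (mderiv i a)).

Definition dispx (s r : C -> C) p := s (conic_disc p) * velx p + r (conic_disc p) * accx p.
Definition dispz (s r : C -> C) p := s (conic_disc p) * velz p + r (conic_disc p) * accz p.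

(** The flow of the conic field when s and r are the functions [time_s] and [time_r]
of a fixed time; more generally any s and r with s^2 = r (2 + d r) give a symmetry. *)
Definition conic_flow (s r : C -> C) : V -> V := shear (dispx s r) (dispz s r) dirx (dirz i).

Lemma conic_flow_coords s r p :
  [/\ conic_flow s r p 0 ix = p 0 ix + dispx s r p, conic_flow s r p 0 iy = p 0 iy &
      zcoord (conic_flow s r p) = shift_coord i (dispz s r p) (zcoord p)].
Proof. exact: add_dirx_dirz. Qed.

Lemma taylor_b s z :
  meval (shift_coord i s z) b = meval z b + s * meval z (mderiv i b) /\
  meval (shift_coord i s z) (mderiv i b) = meval z (mderiv i b).
Proof.
have [-> -> _] := @taylor2 _ _ i s z b (leq_trans db (leqnSn 1)).
by rewrite (mderiv2_degz1 _ db) !mulr0 !addr0.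
Qed.

Lemma conic_entire s r : entire s -> entire r ->
  entire (dispx s r : V -> C) /\ entire (dispz s r : V -> C).
Proof.
move=> es er.
have ev1 : entire (velx : V -> C).
  apply: entireD; first exact: entire_meval.
  by apply: entireM; [exact: entire_coord | exact: entire_meval].
have ev2 : entire (velz : V -> C).
  apply: entireD; last by apply: entireN; exact: entire_meval.
  apply: entireM; last exact: entire_coord.
  by apply: entireM; [exact: entire_cst | exact: entire_coord].
have e2y : entire (fun p : V => 2 * p 0 iy : C).
  by apply: entireM; [exact: entire_cst | exact: entire_coord].
have ea1 : entire (accx : V -> C).
  by apply: entireD; apply: entireM => //; exact: entire_meval.
have ea2 : entire (accz : V -> C).
  apply: entireD; first exact: entireM.
  by apply: entireN; apply: entireM => //; exact: entire_meval.
have ed : entire (conic_disc : V -> C).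
  apply: entireD; first by apply: entireX; exact: entire_meval.
  by apply: entireM => //; exact: entire_meval.
have esd := entire_comp ed es; have erd := entire_comp ed er.
by split; apply: entireD; apply: entireM.
Qed.

(** P is quadratic along the displacement, and its increment is a multiple of
s^2 - r (2 + D r); the cofactor is half the determinant of velocity and
acceleration. *)
Lemma conic_flow_defining s r p : (forall d, s d ^+ 2 = r d * (2 + d * r d)) ->
  defining_fun a b (conic_flow s r p) = defining_fun a b p.
Proof.
move=> sr; have [e1 e2 e3] := conic_flow_coords s r p.
rewrite /defining_fun e1 e2 e3.
have [-> _ _] := taylor2 (dispz s r p) (zcoord p) da.
have [-> _] := taylor_b (dispz s r p) (zcoord p).
have := sr (conic_disc p).
rewrite /dispx /dispz /accx /accz; move: (s (conic_disc p)) (r (conic_disc p)) => S R.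
rewrite /conic_disc /velx /velz.
move: (meval _ a) (meval _ (mderiv i a)) (meval _ (mderiv i (mderiv i a))) (meval _ b) (meval _ (mderiv i b)) (p 0 ix) (p 0 iy).
move=> A A1 A2 B B1 x y h.
apply/eqP; rewrite -subr_eq0; apply/eqP.
set fx := A1 + x * B1; set fz := 2 * x * y - B.
transitivity ((S ^+ 2 - R * (2 + (B1 ^+ 2 + 2 * y * A2) * R)) / 2 *
   (fx * (2 * y * fx - B1 * fz) - fz * (B1 * fx + A2 * fz))).
  by rewrite /fx /fz; field.
by rewrite h subrr !mul0r.
Qed.

Lemma conic_flow_disc s r p :
  [/\ conic_disc (conic_flow s r p) = conic_disc p,
    velx (conic_flow s r p) = velx p + meval (zcoord p) (mderiv i b) * dispx s r p
      + meval (zcoord p) (mderiv i (mderiv i a)) * dispz s r p &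
    velz (conic_flow s r p) = velz p + 2 * p 0 iy * dispx s r p
      - meval (zcoord p) (mderiv i b) * dispz s r p].
Proof.
have [e1 e2 e3] := conic_flow_coords s r p.
have [_ t1 t2] := taylor2 (dispz s r p) (zcoord p) da.
have [t3 t4] := taylor_b (dispz s r p) (zcoord p).
rewrite /conic_disc /velx /velz e1 e2 e3 t1 t2 t3 t4; split; ring.
Qed.

(** The displacement of the reversed flow at the image is the opposite of the
original one, again up to a multiple of s^2 - r (2 + D r). *)
Lemma conic_flowK s r p : (forall d, s d ^+ 2 = r d * (2 + d * r d)) ->
  conic_flow (fun d => - s d) r (conic_flow s r p) = p.
Proof.
move=> sr.
have [e1 e2 e3] := conic_flow_coords s r p.
have [f1 f2 f3] := conic_flow_coords (fun d => - s d) r (conic_flow s r p).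
have [g1 g2 g3] := conic_flow_disc s r p.
have [_ t1 t2] := taylor2 (dispz s r p) (zcoord p) da.
have [t3 t4] := taylor_b (dispz s r p) (zcoord p).
have hx : dispx (fun d => - s d) r (conic_flow s r p) = - dispx s r p.
  rewrite {1}/dispx /accx g1 g2 g3 e3 t2 t4 /dispx /dispz /accx /accz.
  have := sr (conic_disc p); move: (s (conic_disc p)) (r (conic_disc p)) => S R.
  rewrite /conic_disc; move: (velx p) (velz p) => fx fz.
  move: (meval _ (mderiv i (mderiv i a))) (meval _ (mderiv i b)) (p 0 iy) => A2 B1 y h.
  apply/eqP; rewrite -subr_eq0; apply/eqP.
  transitivity ((R * (2 + (B1 ^+ 2 + 2 * y * A2) * R) - S ^+ 2) * (B1 * fx + A2 * fz)).
    by ring.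
  by rewrite h subrr mul0r.
have hz : dispz (fun d => - s d) r (conic_flow s r p) = - dispz s r p.
  rewrite {1}/dispz /accz g1 g2 g3 e2 e3 t4 /dispx /dispz /accx /accz.
  have := sr (conic_disc p); move: (s (conic_disc p)) (r (conic_disc p)) => S R.
  rewrite /conic_disc; move: (velx p) (velz p) => fx fz.
  move: (meval _ (mderiv i (mderiv i a))) (meval _ (mderiv i b)) (p 0 iy) => A2 B1 y h.
  apply/eqP; rewrite -subr_eq0; apply/eqP.
  transitivity ((R * (2 + (B1 ^+ 2 + 2 * y * A2) * R) - S ^+ 2) * (2 * y * fx - B1 * fz)).
    by ring.
  by rewrite h subrr mul0r.
apply: eq_coords; rewrite ?f1 ?f2 ?f3 ?hx ?hz ?e1 ?e2 ?e3 ?addrK //.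
by apply/funext => j; rewrite /shift_coord mulNr addrK.
Qed.

(** In the (x, z_i)-plane D is constant and the displacement is affine, so these
partial derivatives are slopes. *)
Lemma conic_flow_partials s r p (es : entire s) (er : entire r) :
  let A2 := meval (zcoord p) (mderiv i (mderiv i a)) in
  let B1 := meval (zcoord p) (mderiv i b) in
  let S := s (conic_disc p) in let R := r (conic_disc p) in let D := conic_disc p in
  [/\ 'd (dispx s r : V -> C) p dirx = S * B1 + R * D,
      'd (dispx s r : V -> C) p (dirz i) = S * A2,
      'd (dispz s r : V -> C) p dirx = S * (2 * p 0 iy) &
      'd (dispz s r : V -> C) p (dirz i) = - S * B1 + R * D].
Proof.
have [e1 e2] := conic_entire es er.
move=> A2 B1 S R D; split; apply: diff_along_line1 => // h.
- have [c1 c2 c3] := add_dirx p h.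
  rewrite /dispx /accx /velx /velz /S /R /D /conic_disc c1 c2 c3 -/A2 -/B1; ring.
- have [c1 c2 c3] := add_dirz p i h.
  have [_ t1 t2] := taylor2 h (zcoord p) da; have [t3 t4] := taylor_b h (zcoord p).
  rewrite /dispx /accx /velx /velz /S /R /D /conic_disc c1 c2 c3 t1 t2 t3 t4 -/A2 -/B1; ring.
- have [c1 c2 c3] := add_dirx p h.
  rewrite /dispz /accz /velx /velz /S /R /D /conic_disc c1 c2 c3 -/A2 -/B1; ring.
- have [c1 c2 c3] := add_dirz p i h.
  have [_ t1 t2] := taylor2 h (zcoord p) da; have [t3 t4] := taylor_b h (zcoord p).
  rewrite /dispz /accz /velx /velz /S /R /D /conic_disc c1 c2 c3 t1 t2 t3 t4 -/A2 -/B1; ring.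
Qed.

(** The 2 x 2 determinant is (1 + r D)^2 - s^2 D, which is 1 by the relation
between s and r. *)
Lemma conic_flow_unimodular (s r : C -> C) : entire s -> entire r ->
  (forall d, s d ^+ 2 = r d * (2 + d * r d)) -> unimodular_symmetry a b (conic_flow s r).
Proof.
move=> es er sr; split; first by move=> p; exact: conic_flow_defining.
move=> p; have [e1 e2] := conic_entire es er.
have [h11 h12 h21 h22] := conic_flow_partials p es er.
apply: (etrans (det_jacobian_shear e1 e2 h11 h12 h21 h22)).
have := sr (conic_disc p).
move: (s (conic_disc p)) (r (conic_disc p)) => S R; rewrite /conic_disc.
move: (meval _ (mderiv i (mderiv i a))) (meval _ (mderiv i b)) (p 0 iy) => A2 B1 y h.
apply/eqP; rewrite -subr_eq0; apply/eqP.
transitivity ((R * (2 + (B1 ^+ 2 + 2 * y * A2) * R) - S ^+ 2) * (B1 ^+ 2 + 2 * y * A2)).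
  by ring.
by rewrite h subrr mul0r.
Qed.

Lemma conic_flow_symmetry vol (s r : C -> C) : entire s -> entire r ->
  (forall d, s d ^+ 2 = r d * (2 + d * r d)) ->
  entire_symmetry a b vol (conic_flow s r) (conic_flow (fun d => - s d) r).
Proof.
move=> es er sr; have sp := conic_flow_unimodular es er sr.
have [e1 e2] := conic_entire es er.
split.
- exact: entire_shear.
- exact: unimodular_symmetry_homo.
- by move=> p _; exact: conic_flowK.
- by move=> _; exact: sp.
Qed.

Lemma conic_flow_orbit vol (s r : C -> C) p : entire s -> entire r ->
  (forall d, s d ^+ 2 = r d * (2 + d * r d)) ->
  same_orbit a b vol p (conic_flow s r p).
Proof.
move=> es er sr; exists (conic_flow s r), (conic_flow (fun d => - s d) r).
split; [exact: conic_flow_symmetry | | by []].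
have {2}-> : s = fun d => - - s d by apply/funext => d; rewrite opprK.
by apply: conic_flow_symmetry; [exact: entireN | exact: er | move=> d; rewrite sqrrN].
Qed.
End ConicFlow.

(** * Slides inside the slices of constant x, and dilations of x *)

Section Slide.
Context {C : numClosedFieldType} {n : nat}.
Local Notation V := 'rV[C]_n.+3.

Lemma mpoly_ring_ind m (Q : mpoly m C -> Prop) :
  (forall c, Q (mpolyC m c)) -> (forall i, Q (mpolyX C (mnm1 i))) ->
  (forall p q, Q p -> Q q -> Q (p + q)) -> (forall p q, Q p -> Q q -> Q (p * q)) ->
  forall p, Q p.
Proof.
move=> hC hX hD hM p.
have h1 : Q 1 by exact: (hC 1).
have hXn i k : Q (mpolyX C (mnm1 i) ^+ k).
  elim: k => [|k IH]; first by rewrite expr0.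
  by have := hM _ _ (hX i) IH; rewrite -exprS.
rewrite [p]mpolyE; apply: (big_ind Q) => //; first by rewrite -mpolyC0.
move=> e _; rewrite -mul_mpolyC; apply: (hM) => //.
by rewrite mpolyXE_id; apply: (big_ind Q).
Qed.

Definition horizontal (e : V) : Prop := e 0 ix = 0 /\ e 0 iy = 0.

Definition slide_base (e p : V) : V := p + p 0 ix ^+ 2 *: e.

Lemma slide_base_coords e p : horizontal e ->
  [/\ slide_base e p 0 ix = p 0 ix, slide_base e p 0 iy = p 0 iy &
     forall j, zcoord (slide_base e p) j = zcoord p j + p 0 ix ^+ 2 * e 0 (iz j)].
Proof.
by move=> [h1 h2]; split=> [| |j]; rewrite /zcoord !mxE ?h1 ?h2 ?mulr0 ?addr0.
Qed.

Lemma horizontalN e : horizontal e -> horizontal (- e).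
Proof. by move=> [h1 h2]; rewrite /horizontal !mxE h1 h2 oppr0. Qed.

Lemma slide_baseK e p : horizontal e -> slide_base (- e) (slide_base e p) = p.
Proof.
move=> he; have [hx _ _] := slide_base_coords p he.
by rewrite {1}/slide_base hx /slide_base scalerN addrK.
Qed.

Lemma entire_slide_base e : entire (slide_base e).
Proof.
apply: entireD; first exact: entire_id.
by apply: entireZl; apply: entireX; exact: entire_coord.
Qed.

Lemma slide_base_add_diry e p h : slide_base e (p + h *: diry) = slide_base e p + h *: diry.
Proof.
have [hx _ _] := add_diry p h.
by rewrite /slide_base hx addrAC.
Qed.

(** G e p is the divided difference of q between p and p + x^2 e. The antisymmetry
under exchanging the two endpoints makes slides invertible also where x = 0,
where the first equation gives no information on G. *)
Definition slide_quotient (q : mpoly n.+1 C) (G : V -> V -> C) : Prop :=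
  forall e, horizontal e ->
  [/\ forall p, meval (zcoord (slide_base e p)) q = meval (zcoord p) q + p 0 ix ^+ 2 * G e p,
      forall p, G (- e) (slide_base e p) = - G e p,
      entire (G e) &
      forall p h, G e (p + h *: diry) = G e p].

(** For a product, the Leibniz rule with the mean value of each factor at the two
endpoints keeps the divided difference antisymmetric. *)
Lemma slide_quotient_exists (q : mpoly n.+1 C) : exists G, slide_quotient q G.
Proof.
elim/mpoly_ring_ind: q.
- move=> c; exists (fun _ _ => 0) => e _; split=> [p|p||p h]; rewrite ?mevalC ?mulr0 ?addr0 ?oppr0 //.
- move=> i; exists (fun e _ => e 0 (iz i)) => e he; split=> [p|p||p h]; rewrite ?mevalXU ?mxE //.
  by have [_ _ ->] := slide_base_coords p he.
- move=> p1 p2 [G1 h1] [G2 h2]; exists (fun e p => G1 e p + G2 e p) => e he.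
  have [a1 b1 c1 d1] := h1 e he; have [a2 b2 c2 d2] := h2 e he.
  split=> [p|p||p h]; rewrite ?mevalD ?a1 ?a2 ?b1 ?b2 ?d1 ?d2 ?opprD //; first by ring.
  exact: entireD.
move=> p1 p2 [G1 h1] [G2 h2].
pose M e p (r : mpoly n.+1 C) : C :=
  (meval (zcoord (slide_base e p)) r + meval (zcoord p) r) / 2.
exists (fun e p => M e p p1 * G2 e p + M e p p2 * G1 e p) => e he.
have [a1 b1 c1 d1] := h1 e he; have [a2 b2 c2 d2] := h2 e he.
have eM r : entire (fun p => M e p r).
  apply: entireM; last exact: entire_cst.
  apply: entireD; last exact: entire_meval.
  exact: (entire_comp (@entire_slide_base e) (entire_meval r)).
split=> [p|p||p h].
- by rewrite !mevalM /M a1 a2; field.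
- rewrite /M slide_baseK // b1 b2; ring.
- by apply: entireD; apply: entireM.
- rewrite /M slide_base_add_diry d1 d2.
  have [_ _ ->] := add_diry p h; have [_ _ ->] := add_diry (slide_base e p) h.
  by [].
Qed.

Variables a b : mpoly n.+1 C.
Local Notation X := (hypersurface a b).

Section SlideMap.
Variables Ga Gb : V -> V -> C.
Hypotheses (ha : slide_quotient a Ga) (hb : slide_quotient b Gb).

Definition slide_lift e (p : V) : C := Ga e p + p 0 ix * Gb e p.

(** The polynomial flow of x^2 e + (derivative of a + x b along e) d/dy. *)
Definition slide e : V -> V := shear (fun p => p 0 ix ^+ 2) (slide_lift e) e diry.

Lemma slideE e p : slide e p = slide_base e p + slide_lift e p *: diry.
Proof. by []. Qed.

Lemma slide_coords e p : horizontal e ->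
  [/\ slide e p 0 ix = p 0 ix, slide e p 0 iy = p 0 iy + slide_lift e p &
     zcoord (slide e p) = zcoord (slide_base e p)].
Proof.
move=> he; have [h1 h2 h3] := slide_base_coords p he; rewrite slideE.
by have [-> -> ->] := add_diry (slide_base e p) (slide_lift e p); rewrite h1 h2.
Qed.

Lemma slideK e p : horizontal e -> slide (- e) (slide e p) = p.
Proof.
move=> he; have [hx hy hz] := slide_coords p he.
have [_ b1 _ d1] := ha he; have [_ b2 _ d2] := hb he.
have [_ _ _ d1'] := ha (horizontalN he); have [_ _ _ d2'] := hb (horizontalN he).
have [sx _ _] := slide_base_coords p he.
rewrite slideE.
have -> : slide_lift (- e) (slide e p) = - slide_lift e p.
  by rewrite {1}/slide_lift hx slideE d1' d2' b1 b2 /slide_lift; ring.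
rewrite slideE slide_base_add_diry slide_baseK //.
by rewrite scaleNr addrK.
Qed.

Lemma entire_slide_lift e : horizontal e -> entire (slide_lift e).
Proof.
move=> he; have [_ _ c1 _] := ha he; have [_ _ c2 _] := hb he.
by apply: entireD => //; apply: entireM => //; exact: entire_coord.
Qed.

(** Neither x^2 nor the correction of y changes in the direction y, and x^2 does
not change along e, so the Jacobian is unipotent. *)
Lemma slide_unimodular e : horizontal e -> unimodular_symmetry a b (slide e).
Proof.
move=> he; split=> p.
  have [hx hy hz] := slide_coords p he.
  have [a1 _ _ _] := ha he; have [a2 _ _ _] := hb he.
  by rewrite /defining_fun hx hy hz a1 a2 /slide_lift; ring.
have e1 : entire (fun p : V => p 0 ix ^+ 2) by apply: entireX; exact: entire_coord.
have e2 := entire_slide_lift he.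
have h11 : 'd (fun p : V => p 0 ix ^+ 2 : C) p e = 0.
  apply: diff_along_line1 => // h; rewrite mulr0 addr0.
  by rewrite !mxE he.1 mulr0 addr0.
have h12 : 'd (fun p : V => p 0 ix ^+ 2 : C) p diry = 0.
  apply: diff_along_line1 => // h; rewrite mulr0 addr0.
  by have [-> _ _] := add_diry p h.
have h22 : 'd (slide_lift e) p diry = 0.
  apply: diff_along_line1 => // h; rewrite mulr0 addr0.
  have [_ _ _ d1] := ha he; have [_ _ _ d2] := hb he.
  by rewrite /slide_lift d1 d2; have [-> _ _] := add_diry p h.
apply: (etrans (det_jacobian_shear e1 e2 h11 h12 erefl h22)).
by rewrite mulr0 subr0 !addr0 mulr1.
Qed.

Lemma slide_symmetry vol e : horizontal e ->
  entire_symmetry a b vol (slide e) (slide (- e)).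
Proof.
move=> he; split.
- apply: entire_shear; last exact: entire_slide_lift.
  by apply: entireX; exact: entire_coord.
- exact: (unimodular_symmetry_homo (slide_unimodular he)).
- by move=> p _; exact: slideK.
- by move=> _; exact: slide_unimodular.
Qed.
End SlideMap.

Lemma hypersurface_y_unique p q : X p -> X q -> p 0 ix != 0 -> p 0 ix = q 0 ix ->
  zcoord p = zcoord q -> p = q.
Proof.
move=> Xp Xq px hx hz; apply: eq_coords => //.
have px2 : p 0 ix ^+ 2 != 0 by rewrite expf_neq0.
apply: (mulfI px2); move: Xp Xq; rewrite /hypersurface /= => ->.
by rewrite -hx -hz => ->.
Qed.

(** On the slice the slide with e = (z' - z) / x^2 does the job. *)
Lemma slice_same_orbit vol p q : X p -> X q -> p 0 ix != 0 -> p 0 ix = q 0 ix ->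
  same_orbit a b vol p q.
Proof.
move=> Xp Xq px hx.
have [Ga ha] := slide_quotient_exists a; have [Gb hb] := slide_quotient_exists b.
(* The y-component is removed to make e horizontal. *)
pose e : V := (p 0 ix ^+ 2)^-1 *: (q - p - (q 0 iy - p 0 iy) *: diry).
have he : horizontal e.
  by rewrite /horizontal !mxE eqxx /= hx; split; ring.
have st := slide_symmetry ha hb vol he.
exists (slide Ga Gb e), (slide Ga Gb (- e)); split; first exact: st.
  have := slide_symmetry ha hb vol (horizontalN he).
  by rewrite opprK.
have [sx sy sz] := slide_coords Ga Gb p he.
have Xs : X (slide Ga Gb e p) by case: st => _ h _ _; exact: h.
apply: (hypersurface_y_unique Xs Xq); rewrite ?sx //.
rewrite sz; apply/funext => j; have [_ _ ->] := slide_base_coords p he.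
rewrite /zcoord !mxE mulrA mulfV ?expf_neq0 // mul1r eqxx /=.
by rewrite mulr0 subr0; ring.
Qed.
End Slide.

Section Dilation.
Context {C : numClosedFieldType} {n : nat}.
Local Notation V := 'rV[C]_n.+3.
Variables a b : mpoly n.+1 C.
Local Notation X := (hypersurface a b).

Definition dilx (l : C -> C) (p : V) : C := (l (meval (zcoord p) a) - 1) * p 0 ix.
Definition dily (m k : C -> C) (p : V) : C :=
  m (meval (zcoord p) a) ^+ 2 *
    (p 0 iy + meval (zcoord p) b * k (meval (zcoord p) a) *
       (p 0 ix * p 0 iy - meval (zcoord p) b)) - p 0 iy.

(** On X, x (x y - b) = a. If x is multiplied by l and m = 1 / l, the new y is
(a + l x b) / (l x)^2 = m^2 (y + (l - 1) b / x), and (l - 1) / x becomes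
k (x y - b) when l - 1 = k a. Here l, m and k are functions of a(z). *)
Definition dilation (l m k : C -> C) : V -> V := shear (dilx l) (dily m k) dirx diry.

Lemma dilation_coords l m k p :
  [/\ dilation l m k p 0 ix = l (meval (zcoord p) a) * p 0 ix,
      dilation l m k p 0 iy = m (meval (zcoord p) a) ^+ 2 *
        (p 0 iy + meval (zcoord p) b * k (meval (zcoord p) a) *
          (p 0 ix * p 0 iy - meval (zcoord p) b)) &
      zcoord (dilation l m k p) = zcoord p].
Proof.
rewrite /dilation /shear.
have [x1 y1 z1] := add_dirx p (dilx l p).
have [-> -> ->] := add_diry (p + dilx l p *: dirx) (dily m k p).
by rewrite x1 y1 z1 /dilx /dily; split=> //; ring.
Qed.

Lemma dilation_symmetry (l m k k' : C -> C) :
  entire l -> entire m -> entire k ->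
  (forall s, l s * m s = 1) -> (forall s, k s * s = l s - 1) ->
  (forall s, k s + l s * k' s = 0) ->
  entire_symmetry a b false (dilation l m k) (dilation m l k').
Proof.
move=> el em ek lm kl kk'; split; [ | | |by []].
- have ea := @entire_meval C n a; have eb := @entire_meval C n b.
  have ela := entire_comp ea el; have ema := entire_comp ea em.
  have eka := entire_comp ea ek.
  have cx := @entire_coord C n ix; have cy := @entire_coord C n iy.
  apply: entire_shear.
    by apply: entireM => //; apply: entireD => //; exact: entire_cst.
  apply: entireD; last exact: entireN.
  apply: entireM; first exact: entireX.
  apply: entireD => //; apply: entireM; first exact: entireM.
  by apply: entireD; [exact: entireM | exact: entireN].
- move=> p; rewrite /hypersurface /= => Xp.
  have [-> -> ->] := dilation_coords l m k p.
  move: Xp (lm (meval (zcoord p) a)) (kl (meval (zcoord p) a)).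
  move: (meval _ a) (meval _ b) (p 0 ix) (p 0 iy) (l _) (m _) (k _) => A B x y L M K Xp hLM hK.
  have e : x * (x * y - B) = A by rewrite mulrBr mulrA -expr2 Xp; ring.
  transitivity ((L * M) ^+ 2 * (x ^+ 2 * y + x * B * K * (x * (x * y - B)))); first by ring.
  rewrite e hLM Xp expr1n mul1r.
  transitivity (A + x * B + x * B * (K * A)); first by ring.
  by rewrite hK; ring.
move=> p; rewrite /hypersurface /= => Xp.
have [h1 h2 h3] := dilation_coords l m k p.
have [g1 g2 g3] := dilation_coords m l k' (dilation l m k p).
apply: eq_coords; rewrite ?g1 ?g2 ?g3 h3 ?h1 ?h2 //.
  by rewrite mulrA [m _ * _]mulrC lm mul1r.
move: Xp (lm (meval (zcoord p) a)) (kl (meval (zcoord p) a)) (kk' (meval (zcoord p) a)).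
move: (meval _ a) (meval _ b) (p 0 ix) (p 0 iy) (l _) (m _) (k _) (k' _) => A B x y L M K K' Xp hLM hK hKK.
have e : x * (x * y - B) = A by rewrite mulrBr mulrA -expr2 Xp; ring.
(* The function x y - b is multiplied by m = 1 / l. *)
have e2 : L * x * (M ^+ 2 * (y + B * K * (x * y - B))) - B = M * (x * y - B).
  transitivity ((L * M) * M * (x * y + B * (K * (x * (x * y - B)))) - B); first by ring.
  rewrite e hLM hK mul1r.
  transitivity (M * (x * y - B) + (L * M - 1) * B); first by ring.
  by rewrite hLM; ring.
rewrite e2.
transitivity ((L * M) ^+ 2 * (y + B * K * (x * y - B)) + L * (L * M) * B * K' * (x * y - B)).
  by ring.
rewrite hLM.
transitivity (y + B * (x * y - B) * (K + L * K')); first by ring.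
by rewrite hKK; ring.
Qed.
End Dilation.

(** * Transitivity *)

Section Transitivity.
Context {C : numClosedFieldType} {n : nat}.
Local Notation V := 'rV[C]_n.+3.
Variables a b : mpoly n.+1 C.
Local Notation X := (hypersurface a b).
Variables E S : C -> C.
Hypothesis ES : exp_pair E S.

Definition time_flow i t : V -> V := conic_flow a b i (time_s S t) (time_r S t).

Lemma time_flow_orbit vol i t p : (degz i a <= 2)%N -> (degz i b <= 1)%N ->
  same_orbit a b vol p (time_flow i t p).
Proof.
move=> da db; have [es er] := entire_time ES t.
exact: (conic_flow_orbit da db vol p es er (time_sr ES t)).
Qed.

Lemma time_flow_reach vol i p : (degz i a <= 2)%N -> (degz i b <= 1)%N ->
  (velx a b i p != 0) || (accx a b i p != 0) ->
  exists e, forall c, c != e -> exists2 q, same_orbit a b vol p q & q 0 ix = c.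
Proof.
move=> da db hp; have [e he] := time_reach ES (p 0 ix) (conic_disc a b i p) hp.
exists e => c /he[t ht]; exists (time_flow i t p); first exact: time_flow_orbit.
by have [-> _ _] := conic_flow_coords a b i (time_s S t) (time_r S t) p.
Qed.

(** If some a_i with i <= k is nonzero at the point, it is the x-velocity. Otherwise
b is nonzero by (A), the velocity is vertical, equal to - b in the direction z_j,
and the x-acceleration is - b a_jj; here a_jj is nonzero because a_j is affine in
z_j, vanishes at the point, and is not identically zero on the line. *)
Lemma condition_A_escape p : condition_A a b -> X p -> p 0 ix = 0 ->
  exists i, [/\ (degz i a <= 2)%N, (degz i b <= 1)%N &
    (velx a b i p != 0) || (accx a b i p != 0)].
Proof.
move=> [k [dk hk]] Xp x0.
have a0 : meval (zcoord p) a = 0 by move: Xp; rewrite /hypersurface /= x0 expr0n !mul0r addr0.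
have [[i [ik hi]]|hn] := pselect (exists i : 'I_n.+1, (i <= k)%N /\ meval (zcoord p) (mderiv i a) != 0).
  have [da db] := dk i ik; exists i; split => //.
  by rewrite /velx x0 mul0r addr0 hi.
have h0 (i : 'I_n.+1) : (i <= k)%N -> meval (zcoord p) (mderiv i a) = 0.
  by move=> ik; apply/eqP/negPn/negP => hi; apply: hn; exists i.
have [b0 [j jk hj]] := hk _ a0 h0; have [da db] := dk j jk; exists j; split=> //.
apply/orP; right; rewrite /accx /velx x0 mul0r addr0 h0 // mulr0 add0r.
rewrite /velz x0 mulr0 mul0r sub0r mulf_neq0 ?oppr_eq0 //.
apply/negP => /eqP hjj; apply: hj => r hr.
have -> : r = shift_coord j (r j - zcoord p j) (zcoord p).
  apply/funext => i; rewrite /shift_coord.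
  have [->|ij] := eqVneq i j; first by rewrite mulr1 addrC subrK.
  by rewrite mulr0 addr0 hr.
have [_ -> _] := taylor2 (r j - zcoord p j) (zcoord p) da.
by rewrite h0 // hjj mulr0 addr0.
Qed.

Lemma escape_orbit vol p : condition_A a b -> X p ->
  exists2 q, same_orbit a b vol p q & q 0 ix != 0.
Proof.
move=> hA Xp; have [x0|x0] := eqVneq (p 0 ix) 0.
  have [i [da db hi]] := condition_A_escape hA Xp x0.
  have [e he] := time_flow_reach vol da db hi.
  have [c c0 ce] : exists2 c : C, c != 0 & c != e.
    have [e1|e1] := eqVneq e 1; last by exists 1; rewrite ?oner_neq0 // eq_sym.
    by exists 2; rewrite ?e1 ?pnatr_eq0 // (eqr_nat _ 2 1).
  by have [q pq hq] := he c ce; exists q; rewrite ?hq.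
by exists p => //; exact: (slice_same_orbit vol Xp Xp x0 erefl).
Qed.

Lemma slice_point (c : C) z : c != 0 -> exists p, [/\ X p, p 0 ix = c & zcoord p = z].
Proof.
move=> c0.
pose p : V := \row_j (if unlift ord0 j is Some j' then
    (if unlift ord0 j' is Some i then z i else (meval z a + c * meval z b) / c ^+ 2)
  else c).
have px : p 0 ix = c by rewrite mxE unlift_none.
have py : p 0 iy = (meval z a + c * meval z b) / c ^+ 2 by rewrite mxE liftK unlift_none.
have pz : zcoord p = z by apply/funext => i; rewrite /zcoord mxE /iz !liftK.
exists p; split => //.
by rewrite /hypersurface /= px py pz mulrC divfK // expf_neq0.
Qed.

Definition slices_connected vol : Prop := forall c c' : C, c != 0 -> c' != 0 ->
  exists p q : V, [/\ X p, p 0 ix = c, q 0 ix = c' & same_orbit a b vol p q].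

(** Leave x = 0 at both ends, cross from one slice to the other, and use slides
inside the slices. *)
Lemma slices_connected_transitive vol p q : condition_A a b -> slices_connected vol ->
  X p -> X q -> same_orbit a b vol p q.
Proof.
move=> hA hc Xp Xq.
have [p1 pp1 p1x] := escape_orbit vol hA Xp.
have [q1 qq1 q1x] := escape_orbit vol hA Xq.
have Xp1 := same_orbit_mem Xp pp1; have Xq1 := same_orbit_mem Xq qq1.
have [p2 [q2 [Xp2 p2x q2x pq2]]] := hc _ _ p1x q1x.
have Xq2 := same_orbit_mem Xp2 pq2.
apply: (same_orbit_trans pp1).
apply: (same_orbit_trans (slice_same_orbit vol Xp1 Xp2 p1x (esym p2x))).
apply: (same_orbit_trans pq2).
have q2x0 : q2 0 ix != 0 by rewrite q2x.
apply: (same_orbit_trans (slice_same_orbit vol Xq2 Xq1 q2x0 q2x)).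
exact: (same_orbit_sym Xq qq1).
Qed.

(** If a vanished identically so would its derivatives, against the last clause of
(A) at any point. *)
Lemma condition_A_nonzero_value : condition_A a b -> exists z, meval z a != 0.
Proof.
move=> [k [_ hk]]; apply: contrapT => hn.
have a0 z : meval z a = 0 by apply/eqP/negPn/negP => hz; apply: hn; exists z.
have ai i z := meval_eq0_mderiv i a0 z.
have [_ [j _ hj]] := hk (fun=> 0) (a0 _) (fun i _ => ai i _).
by apply: hj => r _.
Qed.

(** With l = E(t a), the quotient k = (l - 1) / a = t E(t a / 2) sinhc((t a / 2)^2)
is entire in a. *)
Lemma dilation_same_orbit t p :
  same_orbit a b false p (dilation a b (fun s => E (t * s)) (fun s => E (- (t * s)))
    (fun s => t * E (t * s / 2) * S ((t * s / 2) ^+ 2)) p).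
Proof.
have [[eE eS] hD _ _ _] := ES.
have em r : entire (fun d : C => r * d).
  by apply: entireM; [exact: entire_cst | exact: entire_id].
have em2 r : entire (fun d : C => r * d / 2).
  by apply: entireM; [exact: em | exact: entire_cst].
have el r : entire (fun s : C => E (r * s)) by exact: entire_comp (em r) eE.
have em' r : entire (fun s : C => E (- (r * s))).
  by apply: (@entire_comp _ _ _ _ (fun d : C => - (r * d)) E _ eE); apply: entireN.
have ek r : entire (fun s : C => r * E (r * s / 2) * S ((r * s / 2) ^+ 2)).
  apply: entireM.
    by apply: entireM; [exact: entire_cst | exact: (entire_comp (em2 r) eE)].
  by apply: (@entire_comp _ _ _ _ (fun d : C => (r * d / 2) ^+ 2) S _ eS); apply: entireX.
have kl r s : (r * E (r * s / 2) * S ((r * s / 2) ^+ 2)) * s = E (r * s) - 1.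
  have h1 := sinhS ES (r * s / 2).
  transitivity (2 * E (r * s / 2) * (r * s / 2 * S ((r * s / 2) ^+ 2))); first by field.
  rewrite h1.
  have -> : E (r * s) = E (r * s / 2) * E (r * s / 2) by rewrite -hD; congr E; field.
  have := exp_pairN ES (r * s / 2).
  move: (E (r * s / 2)) (E (- (r * s / 2))) => e f ef.
  by transitivity (e * e - e * f); [field | rewrite ef].
have kk r s : r * E (r * s / 2) * S ((r * s / 2) ^+ 2) +
    E (r * s) * (- r * E (- r * s / 2) * S ((- r * s / 2) ^+ 2)) = 0.
  have -> : E (r * s) = E (r * s / 2) * E (r * s / 2) by rewrite -hD; congr E; field.
  have -> : - r * s / 2 = - (r * s / 2) by field.
  rewrite sqrrN; have := exp_pairN ES (r * s / 2).
  move: (E (r * s / 2)) (E (- (r * s / 2))) (S _) => e f u ef.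
  transitivity (r * e * u * (1 - e * f)); first by ring.
  by rewrite ef subrr mulr0.
pose k r := fun s : C => r * E (r * s / 2) * S ((r * s / 2) ^+ 2).
exists (dilation a b (fun s => E (t * s)) (fun s => E (- (t * s))) (k t)).
exists (dilation a b (fun s => E (- (t * s))) (fun s => E (t * s)) (k (- t))).
have hN s : E (- t * s) = E (- (t * s)) by rewrite mulNr.
split; last by [].
  apply: dilation_symmetry; [exact: el | exact: em' | exact: ek | | | ].
  - by move=> s; exact: (exp_pairN ES (t * s)).
  - by move=> s; exact: (kl t s).
  - by move=> s; exact: (kk t s).
apply: dilation_symmetry; [exact: em' | exact: el | exact: ek | | | ].
- by move=> s; rewrite mulrC; exact: (exp_pairN ES (t * s)).
- by move=> s; rewrite /k kl mulNr.
- by move=> s; have := kk (- t) s; rewrite opprK hN.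
Qed.

Lemma slices_connected_hol : condition_A a b -> slices_connected false.
Proof.
move=> hA c c' c0 c'0; have [z az] := condition_A_nonzero_value hA.
have [p [Xp px pz]] := slice_point z c0.
have [_ _ hs _ _] := ES.
have [w hw] := hs (c' / c) (mulf_neq0 c'0 (invr_neq0 c0)).
have := dilation_same_orbit (w / meval z a) p.
set q := dilation _ _ _ _ _ _ => pq; exists p, q; split => //.
have [-> _ _] := dilation_coords a b (fun s => E (w / meval z a * s))
  (fun s => E (- (w / meval z a * s)))
  (fun s => w / meval z a * E (w / meval z a * s / 2) * S ((w / meval z a * s / 2) ^+ 2)) p.
by rewrite pz px divfK // hw divfK.
Qed.

Lemma exists_avoiding (e1 e2 : C) : exists c, [/\ c != 0, c != e1 & c != e2].
Proof.
have hn (i j : nat) : i != j -> i%:R != j%:R :> C by rewrite eqr_nat.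
have [h1|h1] := boolP ((1 != e1) && (1 != e2)).
  by exists 1; rewrite oner_neq0; case/andP: h1.
have [h2|h2] := boolP ((2 != e1) && (2 != e2)).
  by exists 2; rewrite pnatr_eq0; case/andP: h2.
have n12 : 1 != 2 :> C by exact: (hn 1%N 2%N).
have n13 : 1 != 3 :> C by exact: (hn 1%N 3%N).
have n23 : 2 != 3 :> C by exact: (hn 2%N 3%N).
exists 3; split; first by rewrite pnatr_eq0.
  apply/eqP => e3; move: h1 h2; rewrite -e3 n13 n23 /= !negbK => /eqP h1 /eqP h2.
  by move/eqP: n12; apply; exact: (etrans h1 (esym h2)).
apply/eqP => e3; move: h1 h2; rewrite -e3 n13 n23 /= !andbT !negbK => /eqP h1 /eqP h2.
by move/eqP: n12; apply; exact: (etrans h1 (esym h2)).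
Qed.

Lemma condition_B_reach (c : C) : condition_B a b -> c != 0 ->
  exists e, forall c', c' != e -> exists p q : V,
    [/\ X p, p 0 ix = c, q 0 ix = c' & same_orbit a b true p q].
Proof.
move=> [k [dk hk]] c0.
have [i ik [z hz]] : exists2 i : 'I_n.+1, (i <= k)%N &
    exists z, meval z (mderiv i a) + c * meval z (mderiv i b) != 0.
  apply: contrapT => hn; apply: hk; exists c => // i ik; apply: meval_eq0 => z.
  rewrite mevalD mevalZ; apply/eqP/negPn/negP => hz.
  by apply: hn; exists i => //; exists z.
have [da db] := dk i ik; have [p [Xp px pz]] := slice_point z c0.
have hp : (velx a b i p != 0) || (accx a b i p != 0) by rewrite /velx px pz hz.
have [e he] := time_flow_reach true da db hp.
by exists e => c' /he[q pq qx]; exists p, q.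
Qed.

Lemma slices_connected_vol : condition_B a b -> slices_connected true.
Proof.
move=> hB c c' c0 c'0.
have [e1 h1] := condition_B_reach hB c0; have [e2 h2] := condition_B_reach hB c'0.
have [d [d0 d1 d2]] := exists_avoiding e1 e2.
have [p1 [q1 [Xp1 p1x q1x pq1]]] := h1 d d1.
have [p2 [q2 [Xp2 p2x q2x pq2]]] := h2 d d2.
exists p1, p2; split => //.
apply: (same_orbit_trans pq1).
have Xq1 := same_orbit_mem Xp1 pq1; have Xq2 := same_orbit_mem Xp2 pq2.
have q1x0 : q1 0 ix != 0 by rewrite q1x.
apply: (same_orbit_trans (slice_same_orbit true Xq1 Xq2 q1x0 (etrans q1x (esym q2x)))).
exact: (same_orbit_sym Xp2 pq2).
Qed.

End Transitivity.
(** * The volume form is a residue, and unimodular symmetries preserve it *)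

Section Residue.
Context {C : numClosedFieldType} {n : nat}.
Local Notation V := 'rV[C]_n.+3.
Variables a b : mpoly n.+1 C.
Local Notation X := (hypersurface a b).
Local Notation P := (defining_fun a b).

Lemma row_col_mx0 (u : V) (v : 'M[C]_(n.+2, n.+3)) :
  row (ord0 : 'I_(1 + n.+2)) (col_mx u v) = u.
Proof.
apply/rowP => k; rewrite !mxE (_ : ord0 = lshift n.+2 (ord0 : 'I_1)); last exact/val_inj.
by rewrite (unsplitK (inl _)).
Qed.

(** For v tangent, u |-> det(u; v) is a linear form on the ambient space that vanishes
on the tangent space, hence is proportional to the differential of P. *)
Lemma bordered_det_proportional q (u : V) j (v : 'M[C]_(n.+2, n.+3)) :
  gradient a b q j 0 != 0 -> v *m gradient a b q = 0 ->
  gradient a b q j 0 * \det (col_mx u v : 'M_n.+3) =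
  (u *m gradient a b q) 0 0 * bordered_det j v.
Proof.
set g := gradient a b q => gj vg.
pose e0 : V := g j 0 *: u - (u *m g) 0 0 *: delta_mx 0 j.
have dl : delta_mx 0 j *m g = (g j 0)%:M :> 'M_1.
  by rewrite -rowE; apply/matrixP => k l; rewrite !ord1 !mxE eqxx mulr1n.
have : \det (col_mx e0 v : 'M_n.+3) = 0.
  apply: (@det_ker _ _ _ g).
    by apply: contraNneq gj => ->; rewrite mxE.
  apply: etrans (mul_col_mx e0 v g) _.
  rewrite vg mulmxBl -!scalemxAl dl [u *m g]mx11_scalar !scale_scalar_mx.
  by rewrite [in X in _ - X]mxE eqxx mulr1n mulrC subrr; exact: col_mx0.
rewrite (@determinant_multilinear _ n.+3 _ (col_mx u v : 'M_n.+3)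
   (col_mx (delta_mx 0 j : 'rV_n.+3) v : 'M_n.+3) ord0 (g j 0) (- (u *m g) 0 0)).
- by rewrite mulNr => /eqP; rewrite subr_eq0 => /eqP.
- by rewrite !row_col_mx0 scaleNr.
- by rewrite !col_row'.
- by rewrite !col_row'.
Qed.

Lemma jacobian_gradient phi p : entire phi -> (forall p, P (phi p) = P p) ->
  jacobian phi p *m gradient a b (phi p) = gradient a b p.
Proof.
move=> e h.
have d1 q v : 'd P q v = (v *m gradient a b q) 0 0.
  exact: (congr1 (fun f => f v) (@diff_val _ _ _ _ _ _ _ (defining_fun_is_diff a b q))).
have eP : entire (P : V -> C) by move=> q; case: (defining_fun_is_diff a b q).
have k (v : V) : (v *m jacobian phi p *m gradient a b (phi p)) 0 0 = (v *m gradient a b p) 0 0.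
  apply: (etrans (esym (d1 (phi p) (v *m jacobian phi p)))).
  apply: (etrans _ (d1 p v)).
  exact: (diff_invariant p v e eP h).
move: (jacobian phi p) (gradient a b (phi p)) (gradient a b p) k => J g1 g2 k.
apply/matrixP => i l; rewrite !ord1.
by have := k (row i 1%:M); rewrite -!row_mul -!mulmxA !mul1mx ![row _ _ _ _]mxE.
Qed.

(** The residue is - det(u; v) / dP(u) for any u transverse to X. Take u = e_j at p and
its image under the Jacobian at phi(p): the numerator is unchanged because the
determinant is 1, the denominator because P o phi = P. *)
Lemma unimodular_symmetry_residue_form phi p j j' (v : 'M[C]_(n.+2, n.+3)) :
  entire phi -> unimodular_symmetry a b phi -> gradient a b p j 0 != 0 -> gradient a b (phi p) j' 0 != 0 ->
  v *m gradient a b p = 0 ->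
  residue_form a b j' (phi p) (v *m jacobian phi p) = residue_form a b j p v.
Proof.
move=> e [hP hd] gj gj' vg.
have J := jacobian_gradient p e hP.
move: (jacobian phi p) J (hd p) => A J dA.
have vg' : v *m A *m gradient a b (phi p) = 0 by rewrite -mulmxA J.
have := bordered_det_proportional (delta_mx 0 j *m A) gj' vg'.
rewrite -mulmxA J -(rowE j (gradient a b p)) [row _ _ _ _]mxE.
have -> : (col_mx (delta_mx 0 j *m A : V) (v *m A) : 'M_n.+3) = (col_mx (delta_mx 0 j : V) v : 'M_n.+3) *m A.
  exact (esym (@mul_col_mx _ 1 n.+2 n.+3 n.+3 (delta_mx 0 j) v A)).
rewrite det_mulmx dA mulr1 -/(bordered_det j v) => h.
rewrite /residue_form !mulNr; congr (- _).
by apply: (mulfI gj'); rewrite mulVKf // ; apply: (mulfI gj); rewrite -h mulrCA mulVKf.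
Qed.
End Residue.

Section MultilinearLimit.
Context {K : numFieldType} {N k : nat}.
Local Notation V := 'rV[K]_N.

(** Joint continuity, for a path of frames that only varies in a fixed direction e:
the rows are replaced one at a time by multilinearity, and each replacement adds
a term with a coefficient that tends to 0. *)
Lemma alternating_multilinear_cvg (T : Type) (F : set_system T) (FF : Filter F)
    (q : T -> V) (p : V) (W : V -> 'M[K]_(k, N) -> K) (s : T -> 'I_k -> K) (e : V) :
  q @ F --> p -> (forall v, {for p, continuous (W^~ v : V -> K)}) ->
  (\forall x \near p, alternating_multilinear (W x)) ->
  (forall i, s^~ i @ F --> (0 : K)) ->
  forall v : 'M[K]_(k, N),
    (fun t => W (q t) (\matrix_(i, j) (v i j - s t i * e 0 j))) @ F --> W p v.
Proof.
move=> hq cW aW hs v.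
(* Only the first m rows of u have been moved. *)
pose M m (u : 'M[K]_(k, N)) t : 'M[K]_(k, N) :=
  \matrix_(i, j) (u i j - (if (i < m)%N then s t i else 0) * e 0 j).
suff h m u : (m <= k)%N -> (fun t => W (q t) (M m u t)) @ F --> W p u.
  have := h k v (leqnn k); apply: cvg_trans; apply: near_eq_cvg; apply: nearW => t.
  by congr (W (q t) _); apply/matrixP => i j; rewrite !mxE ltn_ord.
elim: m u => [|m IH] u mk.
  have h0 t : M 0%N u t = u.
    by apply/matrixP => i j; rewrite mxE mul0r subr0.
  rewrite (_ : (fun t => _) = (W^~ u) \o q); last first.
    by apply/funext => t; rewrite h0.
  exact: (cvg_comp _ _ hq (cW u)).
pose i0 : 'I_k := Ordinal mk.
have hm i : (lift i0 i == m :> nat) = false.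
  by rewrite -[m]/(nat_of_ord i0) eq_sym; exact: negbTE (neq_lift i0 i).
pose u' : 'M[K]_(k, N) := \matrix_(i, j) (if i == i0 then e 0 j else u i j).
have c1 := IH u (ltnW mk); have c2 := IH u' (ltnW mk).
have c3 : (fun t => W (q t) (M m u t) - s t i0 * W (q t) (M m u' t)) @ F --> W p u - 0 * W p u'.
  by apply: cvgB => //; apply: cvgM => //; exact: hs.
rewrite mul0r subr0 in c3; apply: cvg_trans c3; apply: near_eq_cvg.
have : \forall t \near F, alternating_multilinear (W (q t)) by exact: (hq _ aW).
apply: filterS => t [ml _].
rewrite (ml (M m.+1 u t) (M m u t) (M m u' t) i0 1 (- s t i0)) ?mul1r ?mulNr //.
- apply/rowP => j; rewrite !mxE /= ltnSn ltnn eqxx; ring.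
- by apply/matrixP => i j; rewrite !mxE ltnS [in RHS]leq_eqVlt hm.
- apply/matrixP => i j; rewrite !mxE ltnS [in RHS]leq_eqVlt hm.
  by rewrite eq_sym (negbTE (neq_lift i0 i)).
Qed.
End MultilinearLimit.

Section VolumeForm.
Context {C : numClosedFieldType} {n : nat}.
Local Notation V := 'rV[C]_n.+3.
Variables a b : mpoly n.+1 C.
Local Notation X := (hypersurface a b).
Local Notation T := (tangent_space a b).
Variables E S : C -> C.
Hypothesis ES : exp_pair E S.
Variable w : @kform C n.+3 n.+2.
Hypothesis hw : is_volume_form a b w.

Lemma volume_form_residue_x_neq0 p j (v : 'M[C]_(n.+2, n.+3)) : X p -> p 0 ix != 0 ->
  gradient a b p j 0 != 0 -> v *m gradient a b p = 0 -> w p v = residue_form a b j p v.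
Proof.
move=> Xp x0 gj vg; have [_ _ h] := hw.
rewrite h //; last exact/tangent_rowsE.
have gy : gradient a b p iy 0 = p 0 ix ^+ 2.
  by rewrite mxE /gradient_entry liftK unlift_none.
rewrite (residue_form_indep gj (_ : gradient a b p iy 0 != 0) vg); last by rewrite gy expf_neq0.
by rewrite /residue_form bordered_detE gy /= expr1; ring.
Qed.

(** Along the conic flow x = t (S f + t versc g) with velocity f and acceleration g;
if f = 0 the second factor is t g / 2 to leading order. *)
Lemma approach_path p : condition_A a b -> X p -> p 0 ix = 0 ->
  exists q : C -> V, [/\ q t @[t --> (0 : C)^'] --> p, forall t, X (q t) &
    \forall t \near (0 : C)^', q t 0 ix != 0].
Proof.
move=> hA Xp x0; have [i [da db hi]] := condition_A_escape hA Xp x0.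
have [[_ eS] _ _ S0 _] := ES; have eR := entire_versc ES.
pose D := conic_disc a b i p; pose f := velx a b i p; pose g := accx a b i p.
have em : entire (fun t : C => t ^+ 2 * D).
  by apply: entireM; [apply: entireX; exact: entire_id | exact: entire_cst].
have eSD := entire_comp em eS; have eRD := entire_comp em eR.
have es : entire (fun t => time_s S t D) by apply: entireM => //; exact: entire_id.
have er : entire (fun t => time_r S t D).
  by apply: entireM => //; apply: entireX; exact: entire_id.
pose q t := time_flow a b S i t p.
have Xq t : X (q t) := same_orbit_mem Xp (time_flow_orbit ES true t p da db).
have q0 : q 0 = p.
  rewrite /q /time_flow /conic_flow /shear /dispx /dispz /time_s /time_r.
  by rewrite !(mul0r, expr0n) /= !(mul0r, addr0, scale0r).
have eq : entire q.
  apply: (@entireD _ _ _ (fun t => p + dispx a b i (time_s S t) (time_r S t) p *: dirx)).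
    apply: entireD; first exact: entire_cst.
    by apply: entireZl; apply: entireD; (apply: entireM; last exact: entire_cst).
  by apply: entireZl; apply: entireD; (apply: entireM; last exact: entire_cst).
exists q; split => //.
  apply: cvg_within_filter.
  by rewrite -{1}q0; exact: (differentiable_continuous (eq 0)).
have qx t : q t 0 ix = t * (S (t ^+ 2 * D) * f + t * versc S (t ^+ 2 * D) * g).
  have [-> _ _] := conic_flow_coords a b i (time_s S t) (time_r S t) p.
  by rewrite x0 add0r /dispx /time_s /time_r -/D -/f -/g; ring.
have [f0|f0] := eqVneq f 0.
  have g0 : g != 0 by move: hi; rewrite -/f -/g f0 eqxx.
  have : \forall t \near (0 : C), versc S (t ^+ 2 * D) != 0.
    apply: (diff_near_neq0 (eRD 0)).
    by rewrite expr0n mul0r (versc0 ES) mulf_neq0 ?oner_neq0 // invr_eq0 pnatr_eq0.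
  move=> /nbhs_dnbhs; apply: filterS2 (nbhs_dnbhs_neq (0 : C)) => t t0 ht.
  by rewrite qx f0 mulr0 add0r mulf_neq0 // mulf_neq0 // mulf_neq0.
have eh : entire (fun t : C => S (t ^+ 2 * D) * f + t * versc S (t ^+ 2 * D) * g).
  apply: entireD; first by apply: entireM; [exact: eSD | exact: entire_cst].
  apply: entireM; last exact: entire_cst.
  by apply: entireM; [exact: entire_id | exact: eRD].
have h : \forall t \near (0 : C), S (t ^+ 2 * D) * f + t * versc S (t ^+ 2 * D) * g != 0.
  apply: (diff_near_neq0 (eh 0)).
  by rewrite expr0n !mul0r S0 mul1r addr0.
move/nbhs_dnbhs: h; apply: filterS2 (nbhs_dnbhs_neq (0 : C)) => t t0 ht.
by rewrite qx mulf_neq0.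
Qed.

(** At a point with x = 0, take a path in X that leaves x = 0 and project the
frame v along e_j to the tangent spaces of the path; both sides are limits of
their values along the path, which agree. *)
Lemma volume_form_residue p j (v : 'M[C]_(n.+2, n.+3)) : condition_A a b -> X p ->
  gradient a b p j 0 != 0 -> v *m gradient a b p = 0 -> w p v = residue_form a b j p v.
Proof.
move=> hA Xp gj vg; have [x0|x0] := eqVneq (p 0 ix) 0; last exact: volume_form_residue_x_neq0.
have [q [qp Xq qx]] := approach_path hA Xp x0.
have [hol _ _] := hw; have [W hW] := hol p Xp.
have gc l : {for p, continuous (fun r => gradient a b r l 0 : C)}.
  exact/differentiable_continuous/differentiable_gradient.
have vgc i : {for p, continuous (fun r => (v *m gradient a b r) i 0 : C)}.
  apply: differentiable_continuous.
  rewrite (_ : (fun r => _) = \sum_l (fun r => v i l * gradient a b r l 0)); last first.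
    by apply/funext => r; rewrite fct_sumE mxE.
  apply: differentiable_sum => l.
  by apply: differentiableM; [exact: differentiable_cst | exact: differentiable_gradient].
have along (h : V -> C) : {for p, continuous h} -> h (q t) @[t --> (0 : C)^'] --> h p.
  by move=> hc; exact: (cvg_comp _ _ qp hc).
pose s t i := (v *m gradient a b (q t)) i 0 / gradient a b (q t) j 0.
have sc i : s^~ i @ (0 : C)^' --> (0 : C).
  have h0 : (v *m gradient a b p) i 0 / gradient a b p j 0 = 0 by rewrite vg mxE mul0r.
  have : s^~ i @ (0 : C)^' --> (v *m gradient a b p) i 0 / gradient a b p j 0.
    apply: cvgM; first exact: (along _ (vgc i)).
    by apply: cvgV => //; exact: (along _ (gc j)).
  by rewrite h0.
pose vt t : 'M[C]_(n.+2, n.+3) := \matrix_(i, l) (v i l - s t i * (delta_mx 0 j : V) 0 l).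
have c1 : (fun t => W (q t) (vt t)) @ (0 : C)^' --> W p v.
  apply: alternating_multilinear_cvg => //.
  - move=> u; apply: differentiable_continuous.
    by case: (nbhs_singleton hW) => _ h _; exact: h.
  - by apply: filterS hW => r [].
have c2 : (fun t => residue_form a b j (q t) (vt t)) @ (0 : C)^' --> residue_form a b j p v.
  apply: (@alternating_multilinear_cvg _ _ _ _ _ _ _ _ (residue_form a b j)) => //.
  - move=> u; apply: differentiable_continuous.
    rewrite (_ : (fun x => _) = (- bordered_det j u) *: (fun x : V => (gradient a b x j 0)^-1 : C)).
      by apply: differentiableZ; apply: differentiableV => //; exact: differentiable_gradient.
    by apply/funext => x; rewrite -[RHS]/(_ * _) /residue_form; ring.
  - have [m al] := bordered_det_alternating (n := n) (C := C) j.
    apply: (@filterE _ (nbhs p) (nbhs_filter p)) => r; split.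
      by move=> u v1 v2 i c1' c2' h h1 h2; rewrite /residue_form (m _ _ _ _ _ _ h h1 h2); ring.
    by move=> u i i' ii h; rewrite /residue_form (al _ _ _ ii h) mulr0.
have [_ _ /(_ Xp v)] := nbhs_singleton hW.
move=> ->; last exact/tangent_rowsE.
suff c3 : (fun t => residue_form a b j (q t) (vt t)) @ (0 : C)^' --> W p v.
  exact: (cvg_unique _ c3 c2).
apply: cvg_trans c1; apply: near_eq_cvg.
have gq : \forall t \near (0 : C)^', gradient a b (q t) j 0 != 0.
  exact: (qp _ (diff_near_neq0 (differentiable_gradient a b j p) gj)).
have Wq := qp _ hW.
near=> t.
have gt : gradient a b (q t) j 0 != 0 by near: t.
have vgt : vt t *m gradient a b (q t) = 0.
  apply/matrixP => i l; rewrite !ord1 mxE [RHS]mxE.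
  transitivity ((v *m gradient a b (q t)) i 0 - s t i * gradient a b (q t) j 0); last first.
    by rewrite /s divfK ?subrr.
  rewrite [in RHS]mxE; under eq_bigr do rewrite mxE mulrBl.
  rewrite sumrB; congr (_ - _).
  rewrite (bigD1 j) //= big1 => [|l' lj]; first by rewrite mxE !eqxx mulr1 addr0.
  by rewrite mxE (negbTE lj) andbF mulr0 mul0r.
rewrite -(volume_form_residue_x_neq0 (Xq t) _ gt vgt); last by near: t.
have [_ _ h] : [/\ alternating_multilinear (W (q t)),
        forall v, differentiable (W^~ v : V -> C) (q t) &
        X (q t) -> forall v, tangent_rows T (q t) v -> w (q t) v = W (q t) v] by near: t.
by rewrite h //; exact/tangent_rowsE.
Unshelve. all: by end_near.
Qed.

Lemma unimodular_symmetry_preserves_form phi : condition_A a b -> entire phi -> unimodular_symmetry a b phi ->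
  preserves_form X T w phi.
Proof.
move=> hA ephi sp p Xp; exists phi; first exact: entire_holo_extension.
move=> v /tangent_rowsE vg.
have Xphi : X (phi p) := unimodular_symmetry_homo sp Xp.
have [j gj] := condition_A_smooth hA Xp; have [j' gj'] := condition_A_smooth hA Xphi.
rewrite (volume_form_residue hA Xp gj vg).
rewrite -(unimodular_symmetry_residue_form ephi sp gj gj' vg).
apply: volume_form_residue => //.
have [hP _] := sp; have J := jacobian_gradient p ephi hP.
by rewrite -mulmxA J.
Qed.
End VolumeForm.

Section MainAbstract.
Context {C : numClosedFieldType} {n : nat}.
Variables (a b : mpoly n.+1 C) (E S : C -> C).
Hypothesis ES : exp_pair E S.

Lemma transitivity_from_exp_pair : condition_A a b ->
  acts_transitively_on (Aut_hol (hypersurface a b)) (hypersurface a b) /\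
  (condition_B a b -> forall w : kform n.+2, is_volume_form a b w ->
     acts_transitively_on (Aut_vol a b w) (hypersurface a b)).
Proof.
move=> hA; split=> [|hB w hw] p q Xp Xq.
  have [f [g [hf hg fpq]]] := slices_connected_transitive ES hA (slices_connected_hol ES hA) Xp Xq.
  by exists f => //; exact: (entire_symmetry_Aut_hol hf hg).
have [f [g [hf hg fpq]]] := slices_connected_transitive ES hA (slices_connected_vol ES hB) Xp Xq.
exists f => //; split; first exact: (entire_symmetry_Aut_hol hf hg).
have [ef _ _ sp] := hf.
exact: (unimodular_symmetry_preserves_form ES hw hA ef (sp isT)).
Qed.
End MainAbstract.

Theorem proposition3p4 (R : realType) (n : nat) (a b : mpoly n.+1 (Cplx R)) :
  condition_A a b ->
  acts_transitively_on (Aut_hol (hypersurface a b)) (hypersurface a b) /\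
  (condition_B a b ->
   forall w : kform n.+2, is_volume_form a b w ->
     acts_transitively_on (Aut_vol a b w) (hypersurface a b)).
Proof.
move=> hA; have [E [S ES]] := exp_pair_exists R.
exact: (transitivity_from_exp_pair ES hA).
Qed.
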